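(* Assume $f$ is $L$-smooth and the generalized heavy-tailed noise assumption holds with $\alpha\in(1,2]$, $\sigma_0,\sigma_1\ge0$. Let $K\ge1$, $\eta>0$, $\beta\in(0,1)$ and batch size $B>\big(2\sqrt\pi(1+\sqrt{d_0})\mathcal C_\alpha^{1/\alpha}\sigma_1\big)^{\alpha/(\alpha-1)}$, and put $\rho:=1-(1+\sqrt{d_0})\,2\sqrt\pi\,\mathcal C_\alpha^{1/\alpha}\sigma_1/B^{(\alpha-1)/\alpha}>0$, $\Gamma_\alpha:=(2^\alpha+1)^{1/\alpha}$. Then Muon with exact polar decomposition satisfies $$\min_{0\le k\le K-1}\mathbb E\|\nabla f({\bm{X}}_k)\|_F\le\frac{f({\bm{X}}_0)-f_\star}{\eta\rho K}+\frac{Ld_0\eta}{2\rho}+(1+\sqrt{d_0})\frac{\mathbb E\|{\bm{S}}_0\|_F}{(1-\beta)K\rho}+\frac{\beta^2}{(1-\beta)\rho}L\eta\sqrt{d_0}(1+\sqrt{d_0})+(1+\sqrt{d_0})\frac{2\sqrt\pi\,\mathcal C_\alpha^{1/\alpha}}{\rho B^{(\alpha-1)/\alpha}}\Gamma_\alpha\sigma_0(1-\beta)^{\frac{\alpha-1}{\alpha}}+(1+\sqrt{d_0})\frac{2\sqrt\pi\,\mathcal C_\alpha^{1/\alpha}\sigma_1\|\nabla f({\bm{X}}_0)\|_F}{\rho B^{(\alpha-1)/\alpha}K}.$$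
   Context: Norms on $\mathbb{R}^{m\times n}$: $\|\cdot\|_F$ Frobenius; $d_0:=\min\{m,n\}$. $f:\mathbb{R}^{m\times n}\to\mathbb R$ is differentiable with $f\ge f_\star>-\infty$; $L$-smooth means $\|\nabla f({\bm{X}})-\nabla f({\bm{Y}})\|_F\le L\|{\bm{X}}-{\bm{Y}}\|_F$. Muon: given $\beta\in(0,1)$, $\eta>0$, $B\in\mathbb N$, initial ${\bm{X}}_0,{\bm{C}}_{-1}$, for $k=0,1,\dots$: ${\bm{G}}_k=\frac1B\sum_{i=1}^B{\bm{G}}_k^i$, ${\bm{C}}_k=\beta{\bm{C}}_{k-1}+{\bm{G}}_k$, ${\bm{M}}_k=\beta{\bm{C}}_k+{\bm{G}}_k$, ${\bm{X}}_{k+1}={\bm{X}}_k-\eta\mathcal T({\bm{M}}_k)$, with exact polar decomposition $\mathcal T({\bm{M}})={\bm{U}}{\bm{V}}^\top$ for a compact SVD ${\bm{M}}={\bm{U}}\bm\Sigma{\bm{V}}^\top$ ($\mathcal T(\mathbf 0)=\mathbf 0$). $\widetilde{{\bm{M}}}_k:=(1-\beta){\bm{M}}_k$, ${\bm{S}}_k:=\widetilde{{\bm{M}}}_k-\nabla f({\bm{X}}_k)$. $\mathcal F_k$ is the $\sigma$-field of all randomness up to the beginning of iteration $k$ (${\bm{X}}_k$ is $\mathcal F_k$-measurable, ${\bm{G}}_k^i$ are $\mathcal F_{k+1}$-measurable). Generalized heavy-tailed noise assumption: for every $k$, conditionally on $\mathcal F_k$, ${\bm{G}}_k^1,\dots,{\bm{G}}_k^B$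 are independent, $\mathbb E[{\bm{G}}_k^i\mid\mathcal F_k]=\nabla f({\bm{X}}_k)$, and $\mathbb E[\|{\bm{G}}_k^i-\nabla f({\bm{X}}_k)\|_F^\alpha\mid\mathcal F_k]\le\sigma_0^\alpha+\sigma_1^\alpha\|\nabla f({\bm{X}}_k)\|_F^\alpha$. $\mathcal C_\alpha\in(0,2]$ is a constant depending only on $\alpha$ such that for any finitely many independent mean-zero random elements ${\bm{Y}}_i$ of a real Hilbert space with finite $\alpha$-th moments, $\mathbb E\|\sum_i{\bm{Y}}_i\|^\alpha\le\mathcal C_\alpha\sum_i\mathbb E\|{\bm{Y}}_i\|^\alpha$. *)

(* Defs.v *)
From HB Require Import structures.
From mathcomp Require Import all_boot all_order all_algebra.
From mathcomp Require Import all_classical all_reals all_analysis.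
Set Implicit Arguments. Unset Strict Implicit. Unset Printing Implicit Defensive.
Import Order.TTheory GRing.Theory Num.Theory.
Local Open Scope classical_set_scope.
Local Open Scope ring_scope.

Section MatrixDefs.
Context {R : realType}.

Definition frob {m n : nat} (A B : 'M[R]_(m, n)) : R :=
  \sum_(i < m) \sum_(j < n) A i j * B i j.
Definition normF {m n : nat} (A : 'M[R]_(m, n)) : R := Num.sqrt (frob A A).

Definition has_gradient {m n : nat} (f : 'M[R]_(m, n) -> R)
  (g : 'M[R]_(m, n) -> 'M[R]_(m, n)) : Prop :=
  forall (X : 'M[R]_(m, n)) (e : R), 0 < e ->
    exists2 d : R, 0 < d & forall V : 'M[R]_(m, n), normF V < d ->
      `|f (X + V) - f X - frob (g X) V| <= e * normF V.

(* Q = U V^T for a compact SVD  M = U Sigma V^T  (U^T U = I_r, V^T V = I_r,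
   Sigma = diag(s) with s > 0).  For M = 0 this forces r = 0, hence Q = 0. *)
Definition is_polar {m n : nat} (M Q : 'M[R]_(m, n)) : Prop :=
  exists (r : nat) (U : 'M[R]_(m, r)) (s : 'rV[R]_r) (V : 'M[R]_(n, r)),
    [/\ U^T *m U = 1%:M, V^T *m V = 1%:M, (forall i, 0 < s 0 i),
        M = U *m diag_mx s *m V^T & Q = U *m V^T].

(* One Muon step on the state (X_k, C_{k-1}) with stochastic gradient Gk *)
Definition muon_step {m n : nat} (polar : 'M[R]_(m, n) -> 'M[R]_(m, n))
  (beta eta : R) (Gk : 'M[R]_(m, n)) (st : 'M[R]_(m, n) * 'M[R]_(m, n)) :=
  let C := beta *: st.2 + Gk in
  let M := beta *: C + Gk in
  (st.1 - eta *: polar M, C).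

Fixpoint muon_state {m n : nat} (polar : 'M[R]_(m, n) -> 'M[R]_(m, n))
  (beta eta : R) (G : nat -> 'M[R]_(m, n)) (X0 Cm1 : 'M[R]_(m, n)) (k : nat)
  : 'M[R]_(m, n) * 'M[R]_(m, n) :=
  match k with
  | 0%N => (X0, Cm1)
  | k'.+1 => muon_step polar beta eta (G k') (muon_state polar beta eta G X0 Cm1 k')
  end.

End MatrixDefs.

Section ProbDefs.
Context {R : realType} {d : measure_display} {Omega : measurableType d}.

Definition Gbatch {m n B : nat} (Gi : nat -> 'I_B -> Omega -> 'M[R]_(m, n))
  (k : nat) (x : Omega) : 'M[R]_(m, n) :=
  (B%:R)^-1 *: \sum_(i < B) Gi k i x.

Definition muonX {m n B : nat} (polar : 'M[R]_(m, n) -> 'M[R]_(m, n)) (beta eta : R)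
  (Gi : nat -> 'I_B -> Omega -> 'M[R]_(m, n)) (X0 Cm1 : 'M[R]_(m, n))
  (k : nat) (x : Omega) : 'M[R]_(m, n) :=
  (muon_state polar beta eta (fun j => Gbatch Gi j x) X0 Cm1 k).1.

Definition muonM {m n B : nat} (polar : 'M[R]_(m, n) -> 'M[R]_(m, n)) (beta eta : R)
  (Gi : nat -> 'I_B -> Omega -> 'M[R]_(m, n)) (X0 Cm1 : 'M[R]_(m, n))
  (k : nat) (x : Omega) : 'M[R]_(m, n) :=
  let st := muon_state polar beta eta (fun j => Gbatch Gi j x) X0 Cm1 k in
  let C := beta *: st.2 + Gbatch Gi k x in
  beta *: C + Gbatch Gi k x.

Definition Fmeas (F : set (set Omega)) (Y : Omega -> R) : Prop :=
  forall A : set R, measurable A -> F (Y @^-1` A).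

Definition sub_sigma (F : set (set Omega)) : Prop :=
  sigma_algebra setT F /\ F `<=` measurable.

Definition filtration (F : nat -> set (set Omega)) : Prop :=
  (forall k, sub_sigma (F k)) /\ (forall k, F k `<=` F k.+1).

Definition cond_exp_version (P : probability Omega R) (F : set (set Omega))
  (X Y : Omega -> R) : Prop :=
  [/\ Fmeas F Y, P.-integrable setT (EFin \o X), P.-integrable setT (EFin \o Y)
    & forall A, F A -> (\int[P]_(x in A) (X x)%:E = \int[P]_(x in A) (Y x)%:E)%E].

(* Y is a (finite, nonnegative) version of E[X | F] for X >= 0 *)
Definition ncond_exp_version (P : probability Omega R) (F : set (set Omega))
  (X Y : Omega -> R) : Prop :=
  [/\ Fmeas F Y, (forall x, 0 <= Y x)
    & forall A, F A -> (\int[P]_(x in A) (X x)%:E = \int[P]_(x in A) (Y x)%:E)%E].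

End ProbDefs.

Section Borel.
Context {R : realType}.
Definition mx_coord_sets (m n : nat) : set (set 'M[R]_(m, n)) :=
  [set A | exists (i : 'I_m) (j : 'I_n) (E : set R),
      measurable E /\ A = (fun M : 'M[R]_(m, n) => M i j) @^-1` E].
Definition mxBorel {m n : nat} : set (set 'M[R]_(m, n)) := <<s @mx_coord_sets m n >>.
End Borel.

Section Indep.
Context {R : realType} {d : measure_display} {Omega : measurableType d}.

Definition rmx_meas {m n : nat} (Y : Omega -> 'M[R]_(m, n)) : Prop :=
  forall i j, measurable_fun setT (fun x => Y x i j).

Definition mutual_indep (P : probability Omega R) {m n N : nat}
  (Y : 'I_N -> Omega -> 'M[R]_(m, n)) : Prop :=
  forall E : 'I_N -> set 'M[R]_(m, n), (forall i, mxBorel (E i)) ->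
    P (\bigcap_(i in [set: 'I_N]) (Y i @^-1` E i)) =
    (\prod_(i < N) P (Y i @^-1` E i))%E.

Definition cond_indep (P : probability Omega R) (F : set (set Omega)) {m n N : nat}
  (Y : 'I_N -> Omega -> 'M[R]_(m, n)) : Prop :=
  forall E : 'I_N -> set 'M[R]_(m, n), (forall i, mxBorel (E i)) ->
    exists p : 'I_N -> Omega -> R,
      (forall i, cond_exp_version P F (\1_(Y i @^-1` E i)) (p i)) /\
      cond_exp_version P F (\1_(\bigcap_(i in [set: 'I_N]) (Y i @^-1` E i)))
        (fun x => \prod_(i < N) p i x).

Definition heavy_tailed_noise (P : probability Omega R) (F : nat -> set (set Omega))
  {m n B : nat} (Gi : nat -> 'I_B -> Omega -> 'M[R]_(m, n))
  (X : nat -> Omega -> 'M[R]_(m, n)) (gf : 'M[R]_(m, n) -> 'M[R]_(m, n))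
  (alpha sigma0 sigma1 : R) : Prop :=
  forall k : nat,
    [/\ cond_indep P (F k) (Gi k),
        (forall i a b, cond_exp_version P (F k) (fun x => Gi k i x a b)
                                             (fun x => gf (X k x) a b))
      & (forall i, exists Y : Omega -> R,
           ncond_exp_version P (F k) (fun x => normF (Gi k i x - gf (X k x)) `^ alpha) Y /\
           {ae P, forall x, Y x <= sigma0 `^ alpha + sigma1 `^ alpha *
                                    normF (gf (X k x)) `^ alpha})].
End Indep.

Definition vBE_constant {R : realType} (alpha C : R) : Prop :=
  forall (d : measure_display) (Omega : measurableType d) (P : probability Omega R)
         (p N : nat) (Y : 'I_N -> Omega -> 'rV[R]_p),
    (forall k, rmx_meas (Y k)) ->
    mutual_indep P Y ->
    (forall k i j, P.-integrable setT (fun x => (Y k x i j)%:E) /\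
                   (\int[P]_x (Y k x i j)%:E = 0)%E) ->
    (forall k, (\int[P]_x ((normF (Y k x)) `^ alpha)%:E < +oo)%E) ->
    (\int[P]_x ((normF (\sum_(k < N) Y k x)) `^ alpha)%:E <=
       C%:E * \sum_(k < N) \int[P]_x ((normF (Y k x)) `^ alpha)%:E)%E.

(* Main.v *)
Require Import Defs.
From HB Require Import structures.
From mathcomp Require Import all_boot all_order all_algebra.
From mathcomp Require Import all_classical all_reals all_analysis.
From mathcomp Require Import measurable_realfun.
From mathcomp Require Import ring lra.
Set Implicit Arguments. Unset Strict Implicit. Unset Printing Implicit Defensive.
Import Order.TTheory GRing.Theory Num.Theory numFieldNormedType.Exports.
Local Open Scope classical_set_scope.
Local Open Scope ring_scope.

(* Pointwise, the descent lemma and <M, UV^T> = |M|_* >= |M|_F bound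
   eta * sum_k |grad f(X_k)| by f(X_0) - f_* plus (1 + sqrt d0) eta * sum_k |S_k| and a
   second-order term, and S_k is beta^k S_0, plus a drift of norm at most
   beta^2 L eta sqrt d0 / (1 - beta), plus a weighted sum of the batch noises of the
   iterations 0, ..., k.

   The noise sum T_n is a martingale with alpha-th moments controlled by the predictable
   variation A_n = sum_j |c_j|^alpha B^(1-alpha) (sigma0^alpha + sigma1^alpha |grad f(X_j)|^alpha).
   The inequality |u+v|^alpha <= |u|^alpha + alpha |u|^(alpha-2) <u,v> + (1+alpha) |v|^alpha,
   weighted by the predictable factor A_n^(1/alpha - 1), telescopes to
   E[A_n^(1/alpha-1) |T_n|^alpha] <= (1+alpha) alpha E[A_n^(1/alpha)], and Young's inequality with
   parameter 2 A_n^(1/alpha) gives E|T_n| <= 2 sqrt(pi) E[A_n^(1/alpha)]. Subadditivity of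
   t^(1/alpha) then separates sigma0 from sigma1 and leaves only first moments of the
   gradients, which are absorbed by rho. Conditional independence within a batch makes the
   increments of the batch martingale differences one at a time, so that the von Bahr-Esseen
   constant enters only through C_alpha >= 1. *)

(** * Inequalities for real powers *)

(** Bounding E|T_n|^alpha and then taking a root would leave (E|grad f(X_j)|^alpha)^(1/alpha), which
    the first moments E|grad f(X_j)| on the left-hand side do not control. The root therefore has to
    stay inside the expectation, as E[A_n^(1/alpha)]. The weight A_n^(1/alpha - 1) is, up to the
    factor 1/alpha, the derivative of t^(1/alpha) at A_n, so concavity turns every weighted
    increment into a difference of two values of A^(1/alpha). Being a negative power, it needs a
    floor eps > 0 under A_n, which is removed at the end. Absorption by rho requires each E|grad
    f(X_j)| to be counted with total weight at most one over all iterations; this is a bound on the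
    column sums of the noise coefficients. Integrability comes from the polar step: its length is at
    most eta sqrt d0, so |grad f(X_k)| has a deterministic bound for each k. That bound grows with k
    and does not enter the rate. Conditional expectations appear only through integrals over events,
    so products with measurable factors are treated by approximation on level sets. *)

Section PowerInequalities.
Context {R : realType}.
Implicit Types a b c s t x y z : R.

(** Young's inequality for the product t * 1 with exponents a and a / (a - 1); for a = 1, which has
    no conjugate exponent, it is an equality. *)
Lemma bernoulli_powR t a : 0 <= t -> 1 <= a -> 1 + a * (t - 1) <= t `^ a.
Proof.
move=> t0; rewrite le_eqVlt => /orP[/eqP<-|a1]; first by rewrite powRr1//; lra.
have a0 : 0 < a by lra.
have q0 : 0 < a / (a - 1) by apply: divr_gt0; lra.
have conj : a^-1 + (a / (a - 1))^-1 = 1 by field; apply/andP; split; lra.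
have := @conjugate_powR R t 1 a (a / (a - 1)) t0 ler01 a0 q0 conj.
rewrite powR1 mulr1 div1r => h.
have -> : 1 + a * (t - 1) = a * (t - (a / (a - 1))^-1) by field; apply/andP; split; lra.
by rewrite mulrC -ler_pdivlMr// lerBlDr.
Qed.

(** Bernoulli's inequality for the number t^s and the exponent 1/s. *)
Lemma powR_le_affine t s : 0 <= t -> 0 < s <= 1 -> t `^ s <= 1 + s * (t - 1).
Proof.
move=> t0 /andP[s0 s1].
have s1' : 1 <= s^-1 by rewrite invf_ge1.
have := bernoulli_powR (powR_ge0 t s) s1'.
rewrite -powRrM mulfV ?gt_eqF// powRr1// => h.
have : s * (1 + s^-1 * (t `^ s - 1)) <= s * t by rewrite ler_pM2l.
rewrite mulrDr mulrA mulfV ?gt_eqF// mul1r; lra.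
Qed.

(** Concavity of x^s: the tangent at 1, rescaled to the point a through t = b / a. *)
Lemma powR_le_tangent a b s : 0 < a -> 0 <= b -> 0 < s <= 1 ->
  b `^ s <= a `^ s + s * a `^ (s - 1) * (b - a).
Proof.
move=> a0 b0 s01; have s0 : 0 < s by case/andP: s01.
have t0 : 0 <= b / a by rewrite divr_ge0// ltW.
have := powR_le_affine t0 s01.
rewrite -(ler_pM2l (powR_gt0 s a0)) -powRM ?(ltW a0)// => h.
have := mulr_powRB1 (ltW a0) s0 => e.
move: h; rewrite [a * (_ / _)]mulrC mulfVK ?gt_eqF// => /le_trans; apply.
by rewrite -e le_eqVlt; apply/orP; left; apply/eqP; field; rewrite gt_eqF.
Qed.

(** A ratio x / (a + b) in [0, 1] is at most its own s-th power; the two ratios for x = a and x = b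
    add up to 1. *)
Lemma powR_subadditive a b s : 0 <= a -> 0 <= b -> 0 < s <= 1 ->
  (a + b) `^ s <= a `^ s + b `^ s.
Proof.
move=> a0 b0 /andP[s0 s1].
have [->|an0] := eqVneq a 0; first by rewrite add0r powR0 ?gt_eqF// add0r.
have [->|bn0] := eqVneq b 0; first by rewrite addr0 powR0 ?gt_eqF// addr0.
have ap : 0 < a by rewrite lt_neqAle eq_sym an0.
have bp : 0 < b by rewrite lt_neqAle eq_sym bn0.
have cp : 0 < a + b by rewrite addr_gt0.
have sub x : 0 < x -> x <= a + b -> x / (a + b) * (a + b) `^ s <= x `^ s.
  move=> x0 xc; rewrite -[in leRHS](mulfVK (lt0r_neq0 cp) x) powRM ?divr_ge0 ?(ltW cp) ?(ltW x0)//.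
  rewrite ler_wpM2r ?powR_ge0// ger1_powR// divr_gt0//= ler_pdivrMr// mul1r//.
have := lerD (sub a ap _) (sub b bp _); rewrite -mulrDl -mulrDl mulfV ?lt0r_neq0// mul1r.
by apply; rewrite ?lerDl ?lerDr ltW.
Qed.

Lemma powR_sum_le (I : Type) (r : seq I) (E : I -> R) s : (forall i, 0 <= E i) ->
  0 < s <= 1 -> (\sum_(i <- r) E i) `^ s <= \sum_(i <- r) E i `^ s.
Proof.
move=> E0 s01; elim: r => [|i r IH].
  by rewrite !big_nil powR0// gt_eqF//; case/andP: s01.
rewrite !big_cons; apply: le_trans (powR_subadditive _ _ s01) _ => //.
  exact: sumr_ge0.
by rewrite lerD2l.
Qed.

Lemma powR_antitone x y s : 0 < x <= y -> s <= 0 -> y `^ s <= x `^ s.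
Proof.
move=> /andP[x0 xy] s0; have y0 : 0 < y by apply: lt_le_trans xy.
rewrite -[s]opprK [leLHS]powRN [leRHS]powRN lef_pV2 ?posrE ?powR_gt0//.
by rewrite ge0_ler_powR ?nnegrE ?oppr_ge0 ?(ltW x0) ?(ltW y0).
Qed.

Lemma sqr_powR_half x a : 0 <= x -> (x ^+ 2) `^ (a / 2) = x `^ a.
Proof.
by move=> x0; rewrite -powR_mulrn// -powRrM mulrC divfK// pnatr_eq0.
Qed.

(* [z], [x], [y], [c] stand for |u + v|, |u|, |v| and <u, v>. *)
Lemma powR_smoothness x y z c a : 0 <= x -> 0 <= y -> 0 <= z -> 1 < a <= 2 ->
  `|c| <= x * y -> z ^+ 2 = x ^+ 2 + 2 * c + y ^+ 2 ->
  z `^ a <= x `^ a + a * (x `^ (a - 2) * c) + (1 + a) * y `^ a.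
Proof.
move=> x0 y0 z0 /andP[a1 a2] cxy zE.
have a0 : 0 < a by lra.
have s01 : 0 < a / 2 <= 1 by apply/andP; split; lra.
have ya0 := powR_ge0 y a.
(* For x = 0 the factor x^(a - 2) is a mere default value; it is harmless because c = 0 as well. *)
have [x_eq0|xn0] := eqVneq x 0.
  have c0 : c = 0 by apply/eqP; rewrite -normr_le0 (le_trans cxy)// x_eq0 mul0r.
  move: zE; rewrite x_eq0 c0 !mulr0 addr0 expr0n/= add0r => /eqP.
  rewrite eqrXn2// => /eqP ->; rewrite powR0 ?gt_eqF// !add0r ?mulr0.
  by rewrite ler_peMl//; lra.
have xp : 0 < x by rewrite lt_neqAle eq_sym xn0.
have z20 : 0 <= z ^+ 2 by rewrite sqr_ge0.
rewrite -(sqr_powR_half a z0).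
have half1 : (x ^+ 2) `^ (a / 2 - 1) = x `^ (a - 2).
  have -> : a / 2 - 1 = (a - 2) / 2 by field.
  by rewrite sqr_powR_half.
have xa2 := powR_ge0 x (a - 2).
have powS (u : R) : 0 <= u -> u * u `^ (a - 1) = u `^ a by move=> u0; rewrite mulr_powRB1.
have powS2 (u : R) : 0 < u -> u ^+ 2 * u `^ (a - 2) = u `^ a.
  move=> u0; rewrite -powR_mulrn ?(ltW u0)// -powRD; first by congr powR; lra.
  by apply/implyP => _; rewrite gt_eqF.
(* For y <= x the tangent to t^(a/2) at x^2 leaves a remainder y^2 x^(a-2) <= y^a. For x < y this
   remainder may be too large, and the tangent is taken at x^2 + y^2 instead. *)
have [yx|xy] := leP y x.
  apply: le_trans (powR_le_tangent (exprn_gt0 2 xp) z20 s01) _.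
  rewrite sqr_powR_half// half1 zE.
  have -> : a / 2 * x `^ (a - 2) * (x ^+ 2 + 2 * c + y ^+ 2 - x ^+ 2) =
    a * (x `^ (a - 2) * c) + a / 2 * (y ^+ 2 * x `^ (a - 2)) by field.
  rewrite addrA lerD2l.
  have : y ^+ 2 * x `^ (a - 2) <= y `^ a.
    have [->|yn0] := eqVneq y 0; first by rewrite expr0n/= mul0r powR_ge0.
    have yp : 0 < y by rewrite lt_neqAle eq_sym yn0.
    rewrite -(powS2 _ yp) ler_wpM2l ?sqr_ge0//.
    by rewrite powR_antitone ?yp//; lra.
  by move=> h; nra.
have yp : 0 < y by rewrite (lt_trans xp).
have wp : 0 < x ^+ 2 + y ^+ 2 by rewrite addr_gt0 ?exprn_gt0.
apply: le_trans (powR_le_tangent wp z20 s01) _.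
have hw : (x ^+ 2 + y ^+ 2) `^ (a / 2) <= x `^ a + y `^ a.
  by rewrite (le_trans (powR_subadditive _ _ s01)) ?sqr_ge0// !sqr_powR_half.
have w0 := powR_ge0 (x ^+ 2 + y ^+ 2) (a / 2 - 1).
have wx : (x ^+ 2 + y ^+ 2) `^ (a / 2 - 1) <= x `^ (a - 2).
  by rewrite -half1 powR_antitone ?exprn_gt0 ?lerDl ?sqr_ge0//; lra.
(* Replaces the slope at x^2 + y^2 by the larger x^(a-2). For c >= 0 this is free; for c < 0 it
   costs at most |c| x^(a-2) <= y x^(a-1) <= y^a. Multiplied by a, this is the a in the constant 1 +
   a. *)
have hc : c * ((x ^+ 2 + y ^+ 2) `^ (a / 2 - 1) - x `^ (a - 2)) <= y `^ a.
  have [c0|c0] := leP 0 c; first by rewrite (le_trans _ ya0)// mulr_ge0_le0// subr_le0.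
  have cx : - c * x `^ (a - 2) <= y `^ a.
    apply: (@le_trans _ _ (x * y * x `^ (a - 2))).
      by rewrite ler_wpM2r// (le_trans _ cxy)// -normrN ler_norm.
    have -> : x * y * x `^ (a - 2) = y * x `^ (a - 1).
      rewrite mulrAC mulrC -(@mulr_powRB1 _ x (a - 1)) ?(ltW xp)//; last lra.
      by have -> : a - 1 - 1 = a - 2 by lra.
    rewrite -powS// ler_wpM2l// ge0_ler_powR ?nnegrE// ?(ltW xy)//; lra.
  by nra.
by rewrite zE; nra.
Qed.

(** Bernoulli's inequality at t / l, multiplied by l / a. The parameter l will be random, a multiple
    of the root of the variation. *)
Lemma young_powR t l a : 0 <= t -> 0 < l -> 1 <= a ->
  t <= a^-1 * (t `^ a * l `^ (1 - a)) + (1 - a^-1) * l.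
Proof.
move=> t0 l0 a1; have a0 : 0 < a by lra.
have tl : 0 <= t / l by rewrite divr_ge0// ltW.
have := bernoulli_powR tl a1.
have -> : t `^ a * l `^ (1 - a) = l * (t / l) `^ a.
  rewrite powRM ?invr_ge0 ?(ltW l0)// -powR_inv1 ?(ltW l0)// -powRrM mulN1r mulrCA.
  by rewrite powRD ?powRr1 ?(ltW l0)//; apply/implyP => _; rewrite gt_eqF.
rewrite -(ler_pM2l l0) -(ler_pM2l (_ : 0 < a^-1)) ?invr_gt0// => h.
rewrite -lerBlDr (le_trans _ h)// le_eqVlt; apply/orP; left; apply/eqP.
by field; rewrite !gt_eqF.
Qed.

(** The left side is what Young's inequality with l = 2 A^(1/a) produces from the weighted moment
    bound with constant (1 + a) a. Both sides are separated by 14/5, as pi >= 2 already gives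
    sqrt(pi) >= 7/5. *)
Lemma martingale_constant_le a : 1 < a <= 2 ->
  (1 + a) * 2 `^ (1 - a) + (1 - a^-1) * 2 <= 2 * Num.sqrt (pi : R).
Proof.
move=> /andP[a1 a2].
have s2 : (7 / 5 : R) <= Num.sqrt pi.
  rewrite -[leLHS](@ger0_norm R) -?sqrtr_sqr ?ler_wsqrtr; try lra.
  by have := @pi_ge2 R; nra.
have p : 2 `^ (1 - a) <= (3 - a) / 2.
  have [->|an2] := eqVneq a 2.
    have -> : 1 - 2 = - (1 : R) by lra.
    by rewrite powRN powRr1//; lra.
  have := @powR_le_affine 2 (2 - a) ltac:(lra) ltac:(lra).
  have -> : 1 - a = (2 - a) - 1 by lra.
  rewrite (@powRB _ 2 (2 - a) 1) ?pnatr_eq0 ?implybT// powRr1//; lra.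
suff : (1 + a) * 2 `^ (1 - a) + (1 - a^-1) * 2 <= 2 * (7 / 5) by lra.
apply: (@le_trans _ _ ((1 + a) * ((3 - a) / 2) + (1 - a^-1) * 2)).
  by rewrite lerD2r ler_wpM2l//; lra.
rewrite -(ler_pM2l (_ : 0 < a)); last lra.
rewrite mulrDr [a * ((1 - a^-1) * 2)]mulrA mulrBr mulr1 mulfV; last lra.
(* After clearing the denominator a, the claim is a^3 - 2 a^2 - (7/5) a + 4 >= 0, and this cubic
   equals [h1] + 2 [h2] + (7/25) a - 24/125. *)
have h1 : 0 <= (a - 8 / 5) ^+ 2 * (a + 16 / 5) by rewrite mulr_ge0 ?sqr_ge0//; lra.
have h2 : 0 <= (a - 1) * (2 - a) by rewrite mulr_ge0; lra.
by move: h1 h2; rewrite expr2; lra.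
Qed.

End PowerInequalities.

(** * Frobenius norm, polar factor and descent lemma *)

Section Frobenius.
Context {R : realType} {m n : nat}.
Implicit Types A B C : 'M[R]_(m, n).

Lemma frobC A B : frob A B = frob B A.
Proof. by apply: eq_bigr => i _; apply: eq_bigr => j _; rewrite mulrC. Qed.

Lemma frobDl A B C : frob (A + B) C = frob A C + frob B C.
Proof.
rewrite /frob -big_split; apply: eq_bigr => i _ /=.
by rewrite -big_split; apply: eq_bigr => j _ /=; rewrite mxE mulrDl.
Qed.

Lemma frobZl (a : R) A B : frob (a *: A) B = a * frob A B.
Proof.
rewrite /frob mulr_sumr; apply: eq_bigr => i _ /=.
by rewrite mulr_sumr; apply: eq_bigr => j _ /=; rewrite mxE mulrA.
Qed.

Lemma frobNl A B : frob (- A) B = - frob A B.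
Proof. by rewrite -scaleN1r frobZl mulN1r. Qed.

Lemma frobDr A B C : frob A (B + C) = frob A B + frob A C.
Proof. by rewrite frobC frobDl !(frobC A). Qed.

Lemma frobZr (a : R) A B : frob A (a *: B) = a * frob A B.
Proof. by rewrite frobC frobZl (frobC A). Qed.

Lemma frobNr A B : frob A (- B) = - frob A B.
Proof. by rewrite frobC frobNl (frobC A). Qed.

Lemma frob_ge0 A : 0 <= frob A A.
Proof. by apply: sumr_ge0 => i _; apply: sumr_ge0 => j _; rewrite -expr2 sqr_ge0. Qed.

Lemma normF_ge0 A : 0 <= normF A.
Proof. exact: sqrtr_ge0. Qed.

Lemma normF_sqr A : normF A ^+ 2 = frob A A.
Proof. by rewrite sqr_sqrtr// frob_ge0. Qed.

Lemma normF_entry A i j : `|A i j| <= normF A.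
Proof.
rewrite -[leLHS]sqrtr_sqr ler_sqrt ?frob_ge0// /frob (bigD1 i)//= (bigD1 j)//= expr2.
rewrite -addrA lerDl addr_ge0 ?sumr_ge0// => [k _|k _].
  by rewrite -expr2 sqr_ge0.
by rewrite sumr_ge0// => l _; rewrite -expr2 sqr_ge0.
Qed.

Lemma normF_eq0 A : normF A = 0 -> A = 0.
Proof.
move=> A0; apply/matrixP => i j; rewrite mxE; apply/eqP.
by rewrite -normr_le0 -A0 normF_entry.
Qed.

Lemma normF0 : normF (0 : 'M[R]_(m, n)) = 0.
Proof.
by apply/eqP; rewrite -sqrf_eq0 normF_sqr -[X in frob X _](scale0r (0 : 'M[R]_(m, n))) frobZl mul0r.
Qed.

(** Cauchy-Schwarz, by expanding the squared norm of |B|^2 A - <A, B> B. *)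
Lemma frob_le A B : `|frob A B| <= normF A * normF B.
Proof.
have [/normF_eq0 ->|B0] := eqVneq (normF B) 0.
  by rewrite normF0 mulr0 frobC -(scale0r (0 : 'M[R]_(m, n))) frobZl mul0r normr0.
have bp : 0 < normF B ^+ 2 by rewrite exprn_gt0// lt_neqAle eq_sym B0 normF_ge0.
rewrite -(@ger0_norm _ (normF A * normF B)) ?mulr_ge0 ?normF_ge0//.
rewrite -ler_sqr ?nnegrE// !real_normK ?num_real// exprMn -(ler_pM2r bp).
have := frob_ge0 (normF B ^+ 2 *: A - frob A B *: B).
rewrite frobDl !frobDr !frobNl !frobNr !frobZl !frobZr (frobC B A) -!normF_sqr => h.
rewrite -subr_ge0; apply: le_trans h _.
by rewrite le_eqVlt; apply/orP; left; apply/eqP; ring.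
Qed.

Lemma normF_sqrD A B : normF (A + B) ^+ 2 = normF A ^+ 2 + 2 * frob A B + normF B ^+ 2.
Proof. by rewrite !normF_sqr frobDl !frobDr (frobC B A); ring. Qed.

Lemma normFD A B : normF (A + B) <= normF A + normF B.
Proof.
rewrite -ler_sqr ?nnegrE ?addr_ge0 ?normF_ge0// normF_sqrD.
have := le_trans (ler_norm _) (frob_le A B) => h.
by rewrite [leRHS]expr2; nra.
Qed.

Lemma normFZ (a : R) A : normF (a *: A) = `|a| * normF A.
Proof.
by rewrite /normF frobZl frobZr mulrA -expr2 sqrtrM ?sqr_ge0// sqrtr_sqr.
Qed.

Lemma normFN A : normF (- A) = normF A.
Proof. by rewrite -scaleN1r normFZ normrN1 mul1r. Qed.

Lemma normFB A B : normF (A - B) <= normF A + normF B.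
Proof. by rewrite (le_trans (normFD _ _))// normFN. Qed.

Lemma frob_trace A B : frob A B = \tr (A^T *m B).
Proof.
rewrite /frob /mxtrace exchange_big; apply: eq_bigr => j _ /=.
by rewrite mxE; apply: eq_bigr => i _; rewrite mxE.
Qed.

End Frobenius.

Section Polar.
Context {R : realType} {m n : nat}.
Implicit Types M Q : 'M[R]_(m, n).

Lemma orthonormal_columns_le p r (U : 'M[R]_(p, r)) : U^T *m U = 1%:M -> (r <= p)%N.
Proof.
move=> U1; have := mxrankM_maxr U^T U; rewrite U1 mxrank1 => /leq_trans; apply.
exact: rank_leq_row.
Qed.

(** By cyclicity of the trace the squared norm is the number r of singular values, and r orthonormal
    columns fit both in dimension m and in dimension n. *)
Lemma normF_polar_sqr M Q : is_polar M Q -> normF Q ^+ 2 <= (minn m n)%:R.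
Proof.
move=> [r [U [s [V [U1 V1 _ _ ->]]]]].
rewrite normF_sqr frob_trace trmx_mul trmxK mulmxA -(mulmxA V) U1 mulmx1 mxtrace_mulC V1 mxtrace1.
by rewrite ler_nat leq_min !(orthonormal_columns_le U1, orthonormal_columns_le V1).
Qed.

Lemma normF_polar M Q : is_polar M Q -> normF Q <= Num.sqrt (minn m n)%:R.
Proof.
by move=> /normF_polar_sqr h; rewrite -[leLHS]ger0_norm ?normF_ge0// -sqrtr_sqr ler_wsqrtr.
Qed.

(* [frob M Q] is the nuclear norm of [M]. *)
Lemma normF_le_frob_polar M Q : is_polar M Q -> normF M <= frob M Q.
Proof.
move=> [r [U [s [V [U1 V1 s0 -> ->]]]]].
have e1 : frob (U *m diag_mx s *m V^T) (U *m V^T) = \sum_i s 0 i.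
  rewrite frob_trace !trmx_mul trmxK tr_diag_mx -!mulmxA (mulmxA U^T U) U1 mul1mx.
  by rewrite mxtrace_mulC -mulmxA V1 mulmx1 mxtrace_diag.
have e2 : frob (U *m diag_mx s *m V^T) (U *m diag_mx s *m V^T) = \sum_i s 0 i ^+ 2.
  rewrite frob_trace !trmx_mul trmxK tr_diag_mx -!mulmxA (mulmxA U^T U) U1 mul1mx.
  rewrite mxtrace_mulC -!mulmxA V1 mulmx1 mulmx_diag mxtrace_diag.
  by apply: eq_bigr => i _; rewrite mxE expr2.
have s0' i : 0 <= s 0 i by rewrite ltW.
rewrite e1 /normF e2 -[leRHS]ger0_norm ?sumr_ge0// -sqrtr_sqr ler_wsqrtr//.
rewrite expr2 mulr_sumr; apply: ler_sum => i _; rewrite expr2 ler_wpM2r//.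
by rewrite (bigD1 i)//= lerDl sumr_ge0.
Qed.

End Polar.

Section Descent.
Context {R : realType} {m n : nat}.
Variables (f : 'M[R]_(m, n) -> R) (gf : 'M[R]_(m, n) -> 'M[R]_(m, n)) (L : R).
Hypothesis fgrad : has_gradient f gf.
Hypothesis gfL : forall X Y, normF (gf X - gf Y) <= L * normF (X - Y).

Lemma is_derive_along_line (X V : 'M[R]_(m, n)) (t : R) :
  is_derive t 1 (fun u : R => f (X + u *: V)) (frob (gf (X + t *: V)) V).
Proof.
have lim : (fun h : R => h^-1 *: (f (X + (h + t) *: V) - f (X + t *: V)) : R)
    @ (0 : R)^' --> frob (gf (X + t *: V)) V.
  apply/cvgrPdist_le => /= e e0.
  (* The added 1 covers the direction V = 0. *)
  have c0 : 0 < e / (1 + normF V) by rewrite divr_gt0// ltr_wpDr ?normF_ge0.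
  have [d d0 dP] := fgrad (X + t *: V) c0.
  have d'0 : 0 < d / (1 + normF V) by rewrite divr_gt0// ltr_wpDr ?normF_ge0.
  near=> h.
  have hn0 : h != 0 by near: h; exact: nbhs_dnbhs_neq.
  have hd : `|h| < d / (1 + normF V) by near: h; exact: dnbhs0_lt.
  have V0 := normF_ge0 V.
  have hV : normF (h *: V) < d.
    rewrite normFZ; move: hd; rewrite ltr_pdivlMr ?ltr_wpDr// => hd.
    by rewrite (le_lt_trans _ hd)// ler_wpM2l// lerDr.
  have := dP _ hV; rewrite -[X + _ + _]addrA -scalerDl (addrC t) frobZr normFZ => H.
  rewrite -(ler_pM2l (_ : 0 < `|h|)) ?normr_gt0// -normrM mulrBr.
  rewrite /GRing.scale/= mulrA mulfV// mul1r distrC (le_trans H)//.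
  rewrite mulrCA ler_wpM2l// mulrAC ler_pdivrMr ?ltr_wpDr//.
  by rewrite ler_wpM2l ?(ltW e0)// lerDr.
apply: DeriveDef.
  apply/cvg_ex; exists (frob (gf (X + t *: V)) V).
  by under eq_fun do rewrite /= [X in X + t]mulr1.
apply/cvg_lim => //.
by under eq_fun do rewrite /= [X in X + t]mulr1.
Unshelve. all: by end_near. Qed.

(** Mean value theorem for f along the segment minus the quadratic upper model: the Lipschitz
    gradient makes the derivative of [p] nonpositive on [0, 1]. *)
Lemma descent_lemma (X V : 'M[R]_(m, n)) :
  f (X + V) <= f X + frob (gf X) V + L / 2 * normF V ^+ 2.
Proof.
pose N := normF V ^+ 2.
pose p (u : R) := f (X + u *: V) - (frob (gf X) V * u + L / 2 * N * u ^+ 2).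
have dp (t : R) : is_derive t (1 : R) p (frob (gf (X + t *: V)) V - (frob (gf X) V + L * N * t)).
  have dl := is_derive_along_line X V t.
  have -> : p = (fun u : R => f (X + u *: V)) -
      (frob (gf X) V \*: (@id R) + (L / 2 * N) \*: (@id R) ^+ 2) by apply/funext.
  apply: is_derive_eq; rewrite /GRing.scale/= !mulr1 expr1.
  by congr (_ - (_ + _)); field.
have pc : {within `[0, 1], continuous p}.
  by apply: derivable_within_continuous => t _; exact: ex_derive.
have [c] := MVT ltr01 (fun t _ => dp t) pc.
rewrite in_itv/= subr0 mulr1 => /andP[c0 c1].
rewrite /p scale1r scale0r addr0 expr1n expr0n/= !mulr0 !mulr1 addr0 subr0 => e.
suff : frob (gf (X + c *: V)) V - (frob (gf X) V + L * N * c) <= 0 by rewrite -e -/N; lra.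
rewrite opprD addrA -frobNl -frobDl subr_le0.
apply: le_trans (le_trans (ler_norm _) (frob_le _ _)) _.
have := gfL (X + c *: V) X; rewrite [X + _ - _]addrAC subrr add0r normFZ ger0_norm ?(ltW c0)// => h.
rewrite (le_trans (ler_wpM2r (normF_ge0 V) h))// /N expr2 le_eqVlt; apply/orP; left; apply/eqP.
ring.
Qed.

End Descent.

(** * Real-valued integrals *)

Section RealIntegration.
Context {R : realType} {d : measure_display} {T : measurableType d}.
Variable P : probability T R.
Implicit Types (f g h W Z : T -> R) (A : set T).

Lemma integrable_measurable_fun f : P.-integrable setT (EFin \o f) -> measurable_fun setT f.
Proof. by move=> /measurable_int/measurable_EFinP. Qed.

Lemma integrable_ae_dominated f g : measurable_fun setT f ->
  P.-integrable setT (EFin \o g) -> {ae P, forall x, `|f x| <= g x} ->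
  P.-integrable setT (EFin \o f).
Proof.
move=> mf ig fg; apply/integrableP; split; first exact/measurable_EFinP.
have /integrableP[mg gfin] := ig.
apply: le_lt_trans gfin; apply: ae_ge0_le_integral => //.
- by apply/measurable_EFinP; apply: measurableT_comp.
- by apply: measurableT_comp.
by apply: filterS fg => x /= h _; rewrite lee_fin (le_trans h)// ler_norm.
Qed.

Lemma integrable_dominated f g : measurable_fun setT f ->
  P.-integrable setT (EFin \o g) -> (forall x, `|f x| <= g x) ->
  P.-integrable setT (EFin \o f).
Proof. by move=> mf ig fg; apply: integrable_ae_dominated ig _ => //; exact: aeW. Qed.

Lemma integrable_addr f g : P.-integrable setT (EFin \o f) -> P.-integrable setT (EFin \o g) ->
  P.-integrable setT (EFin \o (fun x => f x + g x)).
Proof.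
move=> hf hg; rewrite [X in P.-integrable _ X](_ : _ = (EFin \o f) \+ (EFin \o g))%E//.
exact: integrableD.
Qed.

Lemma integrable_subr f g : P.-integrable setT (EFin \o f) -> P.-integrable setT (EFin \o g) ->
  P.-integrable setT (EFin \o (fun x => f x - g x)).
Proof.
move=> hf hg; rewrite [X in P.-integrable _ X](_ : _ = (EFin \o f) \- (EFin \o g))%E//.
exact: integrableB.
Qed.

Lemma integrable_mulrl (c : R) f : P.-integrable setT (EFin \o f) ->
  P.-integrable setT (EFin \o (fun x => c * f x)).
Proof. by move=> hf; apply: eq_integrable (integrableZl measurableT c hf). Qed.

Lemma integrable_sumr (I : Type) (r : seq I) (E : I -> T -> R) :
  (forall i, P.-integrable setT (EFin \o E i)) ->
  P.-integrable setT (EFin \o (fun x => \sum_(i <- r) E i x)).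
Proof.
move=> hE; rewrite [X in P.-integrable _ X](_ : _ = (fun x => \sum_(i <- r) (E i x)%:E)%E).
  by apply: integrable_sum => // i _; exact: hE.
by apply/funext => x; rewrite /= sumEFin.
Qed.

Lemma integrable_constant (c : R) : P.-integrable setT (EFin \o (fun=> c)).
Proof. exact: finite_measure_integrable_cst. Qed.

Lemma Rintegral_constant (c : R) : \int[P]_x c = c.
Proof.
have h : fine (P setT) = 1 := congr1 fine (probability_setT P).
by rewrite Rintegral_cst// -[RHS]mulr1 -h.
Qed.

Lemma integrable_bounded_mul (c : R) Z W : measurable_fun setT Z -> (forall x, `|Z x| <= c) ->
  P.-integrable setT (EFin \o W) -> P.-integrable setT (EFin \o (fun x => Z x * W x)).
Proof.
move=> mZ Zc iW; apply: (@integrable_dominated _ (fun x => c * `|W x|)).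
- by apply: measurable_funM => //; exact: integrable_measurable_fun.
- by apply: integrable_mulrl; exact: integrable_norm.
- by move=> x; rewrite normrM ler_wpM2r.
Qed.

Lemma integrable_indic_mul A W : measurable A -> P.-integrable setT (EFin \o W) ->
  P.-integrable setT (EFin \o (fun x => \1_A x * W x)).
Proof.
move=> mA; apply: (@integrable_bounded_mul 1); first exact: measurable_indic.
by move=> x; rewrite indicE; case: (_ \in _); rewrite ?normr1 ?normr0.
Qed.

Lemma Rintegral_indic_mul A W : \int[P]_(x in A) W x = \int[P]_x (\1_A x * W x).
Proof.
rewrite Rintegral_mkcond; congr fine; apply: eq_integral => x _.
by rewrite patchE indicE; case: ifP; rewrite ?mul1r ?mul0r.
Qed.

Lemma Rintegral_sumr (I : Type) (r : seq I) (E : I -> T -> R) :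
  (forall i, P.-integrable setT (EFin \o E i)) ->
  \int[P]_x (\sum_(i <- r) E i x) = \sum_(i <- r) \int[P]_x E i x.
Proof.
move=> hE; elim: r => [|i r IH].
  rewrite big_nil; under eq_Rintegral do rewrite big_nil.
  by rewrite Rintegral_cst// mul0r.
rewrite big_cons -IH -RintegralD//; last exact: integrable_sumr.
by apply: eq_Rintegral => x _; rewrite big_cons.
Qed.

Lemma Rintegral_ae_eq f g : measurable_fun setT f -> measurable_fun setT g ->
  {ae P, forall x, f x = g x} -> \int[P]_x f x = \int[P]_x g x.
Proof.
move=> mf mg fg; congr fine; apply: ae_eq_integral => //; try exact/measurable_EFinP.
by apply: filterS fg => x /= -> _.
Qed.

(** The function min(f, g) agrees with f almost everywhere and lies below g everywhere. *)
Lemma ae_le_Rintegral f g : P.-integrable setT (EFin \o f) -> P.-integrable setT (EFin \o g) ->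
  {ae P, forall x, f x <= g x} -> \int[P]_x f x <= \int[P]_x g x.
Proof.
move=> hf hg fg.
rewrite (@Rintegral_ae_eq f (fun x => Num.min (f x) (g x))).
- apply: le_Rintegral => //; last by move=> x _; rewrite ge_min lexx orbT.
  apply: (@integrable_dominated _ (fun x => `|f x| + `|g x|)).
  + by apply: measurable_minr; exact: integrable_measurable_fun.
  + by apply: integrable_addr; exact: integrable_norm.
  + by move=> x; rewrite /Num.min; case: ifP => _; rewrite ?lerDl ?lerDr.
- exact: integrable_measurable_fun.
- by apply: measurable_minr; exact: integrable_measurable_fun.
- by apply: filterS fg => x h; rewrite min_l.
Qed.

Lemma Rintegral_eq0_ae f : P.-integrable setT (EFin \o f) -> (forall x, 0 <= f x) ->
  \int[P]_x f x = 0 -> {ae P, forall x, f x = 0}.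
Proof.
move=> hf f0 i0.
have : ae_eq P setT (EFin \o f) (cst 0%E).
  apply/ae_eq_integral_abs => //; first exact: measurable_int hf.
  rewrite (eq_integral (EFin \o f)); last by move=> x _; rewrite /= ger0_norm.
  have fn := integrable_fin_num measurableT hf.
  by rewrite -(fineK fn); congr EFin.
by apply: filterS => x /(_ I) [].
Qed.

Section FactorThroughLevels.
Variables (Z W : T -> R).
Hypothesis mZ : measurable_fun setT Z.
Hypothesis iW : P.-integrable setT (EFin \o W).
Hypothesis levels : forall E : set R, measurable E -> \int[P]_(x in Z @^-1` E) W x = 0.

Import HBNNSimple.

(** For a simple function in place of [phi] the integral is a finite combination of integrals of W
    over level events of Z, hence zero. Simple approximations from below and dominated convergence,
    with bound |phi(Z) W|, give the general case. *)
Let Rintegral_nonneg_comp_mul_eq0 (phi : R -> R) : measurable_fun setT phi ->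
  (forall y, 0 <= phi y) -> P.-integrable setT (EFin \o (fun x => phi (Z x) * W x)) ->
  \int[P]_x (phi (Z x) * W x) = 0.
Proof.
move=> mphi phi0 iphi.
have mphi' : measurable_fun setT (EFin \o phi) by apply/measurable_EFinP.
pose g := nnsfun_approx measurableT mphi'.
have gphi n y : g n y <= phi y.
  by rewrite -lee_fin nnsfun_approxE; apply: (le_approx n (x := y)) => //= z _; rewrite lee_fin.
have mgZ n : measurable_fun setT (fun x => g n (Z x)) by apply: measurableT_comp.
have g0 n : \int[P]_x (g n (Z x) * W x) = 0.
  under eq_Rintegral do rewrite fimfunEord mulr_suml.
  rewrite Rintegral_sumr => [|i]; last first.
    under eq_fun do rewrite -mulrA.
    apply: integrable_mulrl; apply: (@integrable_bounded_mul 1) => //.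
      apply: (measurableT_comp _ mZ); apply: measurable_indic.
      exact: measurable_sfunP.
    by move=> x; rewrite indicE; case: (_ \in _); rewrite ?normr1 ?normr0.
  rewrite big1// => i _.
  under eq_Rintegral do rewrite -mulrA.
  set s := _`_i; have mE : measurable (g n @^-1` [set s]) by exact: measurable_sfunP.
  have := levels mE; rewrite Rintegral_indic_mul => e.
  rewrite RintegralZl//; first by rewrite -[X in _ * X]/(\int[P]_x (\1_(Z @^-1` (g n @^-1` [set s])) x * W x)) e mulr0.
  apply: (integrable_indic_mul _ iW).
  by rewrite -[X in measurable X]setTI; exact: mZ.
have m1 n : measurable_fun setT (fun x => (g n (Z x) * W x)%:E).
  apply/measurable_EFinP; apply: measurable_funM => //.
  exact: integrable_measurable_fun.
have c1 : {ae P, forall x, setT x -> (fun n => (g n (Z x) * W x)%:E) @ \oo --> (phi (Z x) * W x)%:E}.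
  apply: aeW => x _; apply: cvg_EFin; first by apply: nearW.
  apply: cvgMl.
  have := @cvg_nnsfun_approx _ _ _ _ measurableT _ mphi' (fun y _ => _) (Z x) I.
  by move/(_ (fun y => phi0 y)) => /fine_cvg; apply.
have b1 : {ae P, forall x n, setT x -> (`|(g n (Z x) * W x)%:E| <= `|phi (Z x) * W x|%:E)%E}.
  apply: aeW => x n _; rewrite /= lee_fin !normrM ler_wpM2r//.
  by rewrite !ger0_norm.
have [_ _] := dominated_convergence measurableT m1 (measurable_int _ iphi) c1 (integrable_norm iphi) b1.
rewrite (_ : [sequence _]_n = cst 0%E) => [h|].
  by rewrite /Rintegral -(cvg_lim _ h)// lim_cst.
apply/funext => n /=.
have ign : P.-integrable setT (EFin \o (fun x => g n (Z x) * W x)).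
  apply: (@integrable_dominated _ (fun x => `|phi (Z x) * W x|)).
  - by apply/measurable_EFinP; exact: m1.
  - exact: integrable_norm.
  - by move=> x; rewrite !normrM ler_wpM2r// !ger0_norm.
by rewrite -(fineK (integrable_fin_num measurableT ign)); congr EFin; exact: g0.
Qed.

(** Expresses that E[W | Z] = 0 implies E[Z W] = 0. The positive and negative parts of Z are treated
    separately, each product being dominated by |Z W|, so no moment of Z alone is required. *)
Lemma Rintegral_mul_eq0 : P.-integrable setT (EFin \o (fun x => Z x * W x)) ->
  \int[P]_x (Z x * W x) = 0.
Proof.
move=> iZW.
have iW' : measurable_fun setT W by exact: integrable_measurable_fun.
have mpos : measurable_fun setT (fun y : R => Num.max y 0) by exact: measurable_maxr.
have mneg : measurable_fun setT (fun y : R => Num.max (- y) 0).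
  by apply: measurable_maxr => //; exact: oppr_measurable.
have ipos : P.-integrable setT (EFin \o (fun x => Num.max (Z x) 0 * W x)).
  apply: (@integrable_dominated _ (fun x => `|Z x * W x|)).
  - by apply: measurable_funM => //; exact: (measurableT_comp mpos).
  - exact: integrable_norm.
  - move=> x; rewrite !normrM ler_wpM2r// /Num.max; case: ifP => // _.
    by rewrite normr0.
have ineg : P.-integrable setT (EFin \o (fun x => Num.max (- Z x) 0 * W x)).
  apply: (@integrable_dominated _ (fun x => `|Z x * W x|)).
  - by apply: measurable_funM => //; exact: (measurableT_comp mneg).
  - exact: integrable_norm.
  - move=> x; rewrite !normrM ler_wpM2r// /Num.max; case: ifP => // _.
    by rewrite normr0.
    by rewrite normrN.
rewrite (@eq_Rintegral _ _ _ _ _ (fun x => Num.max (Z x) 0 * W x - Num.max (- Z x) 0 * W x)).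
  rewrite RintegralB//.
  rewrite (Rintegral_nonneg_comp_mul_eq0 mpos)// => [|y]; last by rewrite le_max lexx orbT.
  rewrite (Rintegral_nonneg_comp_mul_eq0 mneg)// => [|y]; last by rewrite le_max lexx orbT.
  by rewrite subrr.
move=> x _; rewrite -mulrBl; congr (_ * _); rewrite /Num.max oppr_lt0.
by case: (ltgtP (Z x) 0) => h; rewrite ?h ?subr0 ?sub0r ?opprK ?oppr0.
Qed.

End FactorThroughLevels.
End RealIntegration.

(** * Sub-sigma-algebras and conditional expectations *)

Section SigmaAlgebraMeasurability.
Context {R : realType} {d : measure_display} {T : measurableType d}.
Implicit Types (F : set (set T)) (X Y Z : T -> R).

(** A sigma-algebra generates itself, so closure properties of [Fmeas] are inherited from
    measurability on the type generated by F. *)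
Lemma FmeasP F Y : sigma_algebra setT F ->
  Fmeas F Y <-> measurable_fun setT (Y : g_sigma_algebraType F -> R).
Proof.
move=> sF; split.
  by move=> h _ A mA; rewrite setTI /measurable/= (sigma_algebra_id sF); exact: h.
move=> h A mA; have := h (@measurableT _ (g_sigma_algebraType F)) A mA.
by rewrite setTI /measurable/= (sigma_algebra_id sF).
Qed.

Lemma sub_sigma_measurable F : sub_sigma F -> F `<=` measurable.
Proof. by case. Qed.

Lemma sub_sigma_algebra_setT F : sub_sigma F -> sigma_algebra setT F.
Proof. by case. Qed.

Lemma sub_sigmaT F : sub_sigma F -> F setT.
Proof. by move=> [[F0 FC _] _]; rewrite -(setD0 setT); exact: FC. Qed.

Lemma sub_sigmaI F A B : sub_sigma F -> F A -> F B -> F (A `&` B).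
Proof.
move=> [sF _]; rewrite -(sigma_algebra_id sF) => FA FB.
exact: (@measurableI _ (g_sigma_algebraType F)).
Qed.

Lemma Fmeas_measurable F Y : sub_sigma F -> Fmeas F Y -> measurable_fun setT Y.
Proof. by move=> [_ sF] FY _ A mA; rewrite setTI; exact/sF/FY. Qed.

Lemma Fmeas_subset F F' Y : F `<=` F' -> Fmeas F Y -> Fmeas F' Y.
Proof. by move=> FF' FY A mA; exact/FF'/FY. Qed.

Section Closure.
Variable F : set (set T).
Hypothesis sF : sub_sigma F.
Let sF' : sigma_algebra setT F := sub_sigma_algebra_setT sF.

Lemma Fmeas_cst (c : R) : Fmeas F (fun=> c).
Proof. by apply/(FmeasP _ sF'); exact: measurable_cst. Qed.

Lemma FmeasD X Y : Fmeas F X -> Fmeas F Y -> Fmeas F (fun x => X x + Y x).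
Proof.
move=> /(FmeasP _ sF') mX /(FmeasP _ sF') mY; apply/(FmeasP _ sF').
exact: measurable_funD.
Qed.

Lemma FmeasB X Y : Fmeas F X -> Fmeas F Y -> Fmeas F (fun x => X x - Y x).
Proof.
move=> /(FmeasP _ sF') mX /(FmeasP _ sF') mY; apply/(FmeasP _ sF').
exact: measurable_funB.
Qed.

Lemma FmeasM X Y : Fmeas F X -> Fmeas F Y -> Fmeas F (fun x => X x * Y x).
Proof.
move=> /(FmeasP _ sF') mX /(FmeasP _ sF') mY; apply/(FmeasP _ sF').
exact: measurable_funM.
Qed.

Lemma Fmeas_sum (I : Type) (r : seq I) (E : I -> T -> R) : (forall i, Fmeas F (E i)) ->
  Fmeas F (fun x => \sum_(i <- r) E i x).
Proof.
move=> mE; apply/(FmeasP _ sF'); apply: (@measurable_sum _ (g_sigma_algebraType F)) => i.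
exact/(FmeasP _ sF').
Qed.

Lemma Fmeas_comp (phi : R -> R) X : measurable_fun setT phi -> Fmeas F X ->
  Fmeas F (fun x => phi (X x)).
Proof.
move=> mphi /(FmeasP _ sF') mX; apply/(FmeasP _ sF').
exact: measurableT_comp mphi mX.
Qed.

Lemma Fmeas_powR a X : Fmeas F X -> Fmeas F (fun x => X x `^ a).
Proof. by apply: (Fmeas_comp (phi := fun y => y `^ a)); exact: measurable_powR. Qed.

Lemma Fmeas_normF (m n : nat) (M : T -> 'M[R]_(m, n)) :
  (forall a b, Fmeas F (fun x => M x a b)) -> Fmeas F (fun x => normF (M x)).
Proof.
move=> mM; apply: (Fmeas_comp (phi := @Num.sqrt R)).
  by apply: continuous_measurable_fun; exact: sqrt_continuous.
by apply: Fmeas_sum => a; apply: Fmeas_sum => b; exact: FmeasM.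
Qed.

Lemma Fmeas_indic A : F A -> Fmeas F (\1_A : T -> R).
Proof.
move=> FA; apply/(FmeasP _ sF'); apply: (@measurable_indic _ (g_sigma_algebraType F)).
by rewrite /measurable/= sigma_algebra_id.
Qed.

End Closure.

Lemma sub_sigma_full : sub_sigma (@measurable _ T).
Proof. by split => //; exact: sigma_algebra_measurable. Qed.

Lemma measurable_normF (m n : nat) (M : T -> 'M[R]_(m, n)) :
  rmx_meas M -> measurable_fun setT (fun x => normF (M x)).
Proof.
move=> mM; apply: (Fmeas_measurable sub_sigma_full); apply: (Fmeas_normF sub_sigma_full) => a b.
by move=> A mA; rewrite -[X in measurable X]setTI; exact: mM.
Qed.

End SigmaAlgebraMeasurability.

Section ConditionalExpectation.
Context {R : realType} {d : measure_display} {T : measurableType d}.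
Variable P : probability T R.
Implicit Types (F : set (set T)) (W X Y Z : T -> R).

Lemma Rintegral_subr A X Y : measurable A -> P.-integrable setT (EFin \o X) ->
  P.-integrable setT (EFin \o Y) ->
  \int[P]_(x in A) (X x - Y x) = \int[P]_(x in A) X x - \int[P]_(x in A) Y x.
Proof. by move=> mA iX iY; rewrite RintegralB//; apply: integrableS iX + apply: integrableS iY. Qed.

(** Pull-out property: the level events of Z belong to F, and X - Y integrates to zero over them. *)
Lemma cond_exp_mul F X Y Z : sub_sigma F -> cond_exp_version P F X Y -> Fmeas F Z ->
  P.-integrable setT (EFin \o (fun x => Z x * X x)) ->
  P.-integrable setT (EFin \o (fun x => Z x * Y x)) ->
  \int[P]_x (Z x * X x) = \int[P]_x (Z x * Y x).
Proof.
move=> sF [_ iX iY XY] FZ iZX iZY; apply/eqP; rewrite -subr_eq0 -RintegralB//.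
under eq_Rintegral do rewrite -mulrBr.
apply/eqP; apply: Rintegral_mul_eq0.
- exact: Fmeas_measurable FZ.
- exact: integrable_subr.
- move=> E mE; have FE := FZ E mE; rewrite Rintegral_subr//; last exact: (sub_sigma_measurable sF).
  by rewrite /Rintegral (XY _ FE) subrr.
- by under eq_fun do rewrite mulrBr; exact: integrable_subr.
Qed.

Lemma cond_exp_cst F (c : R) : sub_sigma F -> cond_exp_version P F (fun=> c) (fun=> c).
Proof. by move=> sF; split => //; [exact: Fmeas_cst|exact: integrable_constant..]. Qed.

(** The event D = {Y > Y'} lies in F, where the integral of Y - Y' equals that of X - X' <= 0; so
    the nonnegative function 1_D (Y - Y') vanishes almost everywhere. *)
Lemma cond_exp_le F X X' Y Y' : sub_sigma F -> cond_exp_version P F X Y ->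
  cond_exp_version P F X' Y' -> (forall x, X x <= X' x) -> {ae P, forall x, Y x <= Y' x}.
Proof.
move=> sF [mY iX iY XY] [mY' iX' iY' XY'] le.
pose D := (fun x => Y x - Y' x) @^-1` `]0, +oo[%classic.
have FD : F D by apply: (FmeasB sF mY mY').
have mD := sub_sigma_measurable sF FD.
have iD : P.-integrable setT (EFin \o (fun x => \1_D x * (Y x - Y' x))).
  by apply: integrable_indic_mul => //; exact: integrable_subr.
have D0 x : 0 <= \1_D x * (Y x - Y' x).
  rewrite indicE; have [|] := boolP (x \in D); last by rewrite mul0r.
  by rewrite inE /D/= in_itv/= andbT mul1r => /ltW.
have : \int[P]_x (\1_D x * (Y x - Y' x)) = 0.
  apply/eqP; rewrite eq_le Rintegral_ge0// andbT -Rintegral_indic_mul Rintegral_subr//.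
  rewrite /Rintegral -(XY _ FD) -(XY' _ FD) -!/(Rintegral _ _ _) subr_le0.
  by apply: le_Rintegral => //; apply: integrableS iX + apply: integrableS iX'.
move=> /(Rintegral_eq0_ae iD D0); apply: filterS => x; rewrite indicE.
have [|] := boolP (x \in D).
  by rewrite inE /D/= in_itv/= andbT mul1r => h h0; move: h; rewrite h0 ltxx.
by move=> h _; rewrite leNgt; apply: contra h => h; rewrite inE /D/= in_itv/= andbT subr_gt0.
Qed.

Lemma cond_exp_unique F X Y Y' : sub_sigma F -> cond_exp_version P F X Y ->
  cond_exp_version P F X Y' -> {ae P, forall x, Y x = Y' x}.
Proof.
move=> sF XY XY'; have h1 := cond_exp_le sF XY XY' (fun=> lexx _).
have h2 := cond_exp_le sF XY' XY (fun=> lexx _).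
by apply: filterS2 h1 h2 => x a b; apply/eqP; rewrite eq_le a b.
Qed.

End ConditionalExpectation.

(** * Conditional independence *)

Section ConditionalIndependence.
Context {R : realType} {d : measure_display} {T : measurableType d}.
Variables (P : probability T R) (F : set (set T)) (m n N : nat).
Variables (G : 'I_N -> T -> 'M[R]_(m, n)).
Hypothesis sF : sub_sigma F.
Hypothesis indepG : cond_indep P F G.

Lemma mxBorel_setT : @mxBorel R m n setT.
Proof. by rewrite /mxBorel; apply: (@measurableT _ (g_sigma_algebraType _)). Qed.

Lemma mxBorelI (A B : set 'M[R]_(m, n)) : mxBorel A -> mxBorel B -> mxBorel (A `&` B).
Proof. exact: (@measurableI _ (g_sigma_algebraType _)). Qed.

Lemma mxBorel_entry i j (E : set R) : measurable E ->
  mxBorel ((fun M : 'M[R]_(m, n) => M i j) @^-1` E).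
Proof. by move=> mE; apply: sub_sigma_algebra; exists i, j, E. Qed.

Lemma Rintegral_ce_indic (A S : set T) (Y : T -> R) : cond_exp_version P F (\1_S) Y -> F A ->
  \int[P]_x (\1_A x * \1_S x) = \int[P]_x (\1_A x * Y x).
Proof. by move=> [_ _ _ h] FA; rewrite -!Rintegral_indic_mul /Rintegral (h _ FA). Qed.

Variables (i : 'I_N) (a : 'I_m) (b : 'I_n) (g : T -> R).
Hypothesis ceG : cond_exp_version P F (fun x => G i x a b) g.

(* Both E[1_H | F] and E[1_H G_i | F] are computed through the law of [G i] given [F]: with
   q := E[1_H | F], the variable 1_A (1_H - q) integrates to zero over every level set of the
   entry [G i x a b], so that 1_H may be replaced by q in front of that entry. *)
Lemma cond_indep_orthogonal (A : set T) (E : 'I_N -> set 'M[R]_(m, n)) : F A ->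
  (forall l, mxBorel (E l)) -> E i = setT ->
  \int[P]_(x in A `&` \bigcap_(l in [set: 'I_N]) (G l @^-1` E l)) (G i x a b - g x) = 0.
Proof.
move=> FA mE Ei; have mA := sub_sigma_measurable sF FA.
set H := \bigcap_(l in _) _.
have [p [ceE ceH]] := indepG mE.
set q := fun x => \prod_(l < N) p l x in ceH.
have mH : measurable H.
  by case: ceH => _ /integrable_measurable_fun/measurable_indicP.
have [Fg iG ig _] := ceG; have [Fq iH iq _] := ceH.
have mq := Fmeas_measurable sF Fq; have mg := Fmeas_measurable sF Fg.
have mG := integrable_measurable_fun iG.
(* As a version of a conditional probability, q lies in [0, 1] almost everywhere; this makes every
   product with q below integrable. *)
have q1 : {ae P, forall x, q x <= 1}.
  apply: (cond_exp_le sF ceH (cond_exp_cst P 1 sF)) => x.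
  by rewrite indicE; case: (_ \in _).
have q0 : {ae P, forall x, 0 <= q x}.
  apply: (cond_exp_le sF (cond_exp_cst P 0 sF) ceH) => x.
  by rewrite indicE; case: (_ \in _).
have indle S x : `|(\1_S : T -> R) x| <= 1.
  by rewrite indicE; case: (_ \in _); rewrite ?normr1 ?normr0.
have m1 S : measurable S -> measurable_fun setT (\1_S : T -> R) by move=> mS; exact: measurable_indic.
have iqX X : P.-integrable setT (EFin \o X) ->
    P.-integrable setT (EFin \o (fun x => \1_A x * q x * X x)).
  move=> iX; apply: (integrable_ae_dominated _ (integrable_norm iX)).
    by apply: measurable_funM; [apply: measurable_funM => //; exact: m1|exact: (integrable_measurable_fun iX)].
  apply: filterS2 q0 q1 => x x0 x1; rewrite /= !normrM ler_piMl// mulr_ile1//.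
  by rewrite ger0_norm.
have levels e : measurable e ->
    \int[P]_(x in (fun x => G i x a b) @^-1` e) (\1_A x * \1_H x - \1_A x * q x) = 0.
  move=> me.
  set S := _ @^-1` e.
  (* The vacant slot i receives the event that the entry lies in e, so that H intersected with S is
     again of product form. *)
  pose E' l := if l == i then (fun M : 'M[R]_(m, n) => M a b) @^-1` e else E l.
  have mE' l : mxBorel (E' l) by rewrite /E'; case: eqP => // _; exact: mxBorel_entry.
  have [p' [ceE' ceH']] := indepG mE'.
  have HS : \bigcap_(l in [set: 'I_N]) (G l @^-1` E' l) = H `&` S.
    apply/seteqP; split => x /=.
      move=> h; split; last by have := h i I; rewrite /E' eqxx.
      by move=> l _; have := h l I; rewrite /E'; case: eqP => // -> _; rewrite Ei.
    by move=> [h1 h2] l _; rewrite /E'; case: eqP => [->//|_]; exact: h1.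
  (* The versions p' and p come from two separate uses of conditional independence. By uniqueness
     they agree almost everywhere for l != i, and p i = 1 because the slot i of E is
     unconstrained. *)
  have pp : {ae P, forall x, \prod_(l < N) p' l x = q x * p' i x}.
    have h l : {ae P, forall x, l != i -> p' l x = p l x}.
      have [->|li] := eqVneq l i; first by apply: aeW => x; rewrite ?eqxx.
      have := ceE' l; rewrite /E' (negbTE li) => h'.
      by apply: filterS (cond_exp_unique sF h' (ceE l)) => x -> _.
    have hi : {ae P, forall x, p i x = 1}.
      have := ceE i; rewrite Ei preimage_setT => h'.
      apply: (cond_exp_unique sF h').
      rewrite (_ : \1_[set: T] = (fun=> 1)); first exact: cond_exp_cst.
      by apply/funext => x; rewrite indicE in_setT.
    have hall : {ae P, forall x, forall l, l != i -> p' l x = p l x}.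
      exact: (@filter_forall _ _ (fun l x => l != i -> p' l x = p l x) _ (ae_filter_ringOfSetsType P) h).
    apply: filterS2 hall hi => x h1 h2; rewrite /q (bigD1 i)//= [in RHS](bigD1 i)//= h2 mul1r mulrC.
    by congr (_ * _); apply: eq_bigr => l li; rewrite h1.
  have mS : measurable S by rewrite -[S]setTI; exact: mG.
  have ceS : cond_exp_version P F (\1_S) (p' i).
    by have := ceE' i; rewrite /E' eqxx.
  have [Fp' iS ip' _] := ceS.
  have mp' := Fmeas_measurable sF Fp'.
  have eq1 : \int[P]_x (\1_A x * \1_(H `&` S) x) = \int[P]_x (\1_A x * q x * p' i x).
    rewrite -HS (Rintegral_ce_indic ceH' FA).
    have [Fp iHS ipp _] := ceH'; apply: Rintegral_ae_eq.
    - by apply: measurable_funM; [exact: m1|exact: Fmeas_measurable Fp].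
    - by apply: measurable_funM => //; apply: measurable_funM => //; exact: m1.
    - by apply: filterS pp => x ->; rewrite mulrA.
  have eq2 : \int[P]_x (\1_A x * q x * \1_S x) = \int[P]_x (\1_A x * q x * p' i x).
    apply: (cond_exp_mul sF ceS); [by apply: FmeasM => //; exact: Fmeas_indic|exact: iqX..].
  rewrite Rintegral_subr//; last 2 first.
  - exact: integrable_indic_mul.
  - exact: integrable_indic_mul.
  rewrite [X in X - _]Rintegral_indic_mul [X in _ - X]Rintegral_indic_mul.
  apply/eqP; rewrite subr_eq0; apply/eqP; transitivity (\int[P]_x (\1_A x * \1_(H `&` S) x)).
    by apply: eq_Rintegral => x _; rewrite indicI /= mulrCA; congr (_ * _); rewrite mulrC.
  by rewrite eq1 -eq2; apply: eq_Rintegral => x _; rewrite mulrC.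
have iHX X : P.-integrable setT (EFin \o X) ->
    P.-integrable setT (EFin \o (fun x => \1_A x * \1_H x * X x)).
  move=> iX; under eq_fun do rewrite -mulrA.
  by do 2 apply: integrable_indic_mul => //.
have iW : P.-integrable setT (EFin \o (fun x => \1_A x * \1_H x - \1_A x * q x)).
  by apply: integrable_subr; apply: integrable_indic_mul.
have GW : \int[P]_x (G i x a b * (\1_A x * \1_H x - \1_A x * q x)) = 0.
  apply: Rintegral_mul_eq0 => //.
  under eq_fun do rewrite mulrBr ![_ * (_ * _)]mulrC.
  by apply: integrable_subr; [exact: iHX|exact: iqX].
(* The chain is E[1_A 1_H G] = E[1_A q G] = E[1_A q g] = E[1_A 1_H g]. *)
have e1 : \int[P]_x (\1_A x * \1_H x * G i x a b) = \int[P]_x (\1_A x * q x * G i x a b).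
  apply/eqP; rewrite -subr_eq0 -RintegralB//; [|exact: iHX|exact: iqX].
  by apply/eqP; rewrite -GW; apply: eq_Rintegral => x _; rewrite -mulrBl mulrC.
have e2 : \int[P]_x (\1_A x * q x * G i x a b) = \int[P]_x (\1_A x * q x * g x).
  by apply: (cond_exp_mul sF ceG); [apply: FmeasM => //; exact: Fmeas_indic|exact: iqX..].
have e3 : \int[P]_x (\1_A x * \1_H x * g x) = \int[P]_x (\1_A x * q x * g x).
  transitivity (\int[P]_x (\1_A x * g x * \1_H x)).
    by apply: eq_Rintegral => x _; rewrite mulrAC.
  transitivity (\int[P]_x (\1_A x * g x * q x)); last first.
    by apply: eq_Rintegral => x _; rewrite mulrAC.
  apply: (cond_exp_mul sF ceH).
  - by apply: FmeasM => //; exact: Fmeas_indic.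
  - by under eq_fun do rewrite mulrAC; exact: iHX.
  - by under eq_fun do rewrite mulrAC; exact: iqX.
rewrite Rintegral_indic_mul.
under eq_Rintegral do rewrite indicI mulrBr.
rewrite RintegralB//; [|exact: iHX|exact: iHX].
by rewrite e1 e2 e3 subrr.
Qed.

End ConditionalIndependence.

(** * Enlarging [F] by part of a batch *)

Section SigmaAlgebraExtension.
Context {R : realType} {d : measure_display} {T : measurableType d}.
Variable P : probability T R.

(** Dynkin's pi-lambda theorem: the events over which W integrates to zero form a lambda-system. The
    vanishing total integral serves for complements. *)
Lemma Rintegral_eq0_g_sigma (C : set (set T)) (W : T -> R) :
  P.-integrable setT (EFin \o W) -> setI_closed C -> C `<=` measurable ->
  \int[P]_x W x = 0 -> (forall S, C S -> \int[P]_(x in S) W x = 0) ->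
  forall S, <<s C >> S -> \int[P]_(x in S) W x = 0.
Proof.
move=> iW CI Cm W0 CW.
pose H := [set S | measurable S /\ \int[P]_(x in S) W x = 0].
suff CH : <<s C >> `<=` H by move=> S /CH [].
rewrite -setI_closed_g_dynkin_g_sigma_algebra//; apply: smallest_sub; last first.
  by move=> S CS; split; [exact: Cm|exact: CW].
split; first by split.
- move=> S [mS S0]; split; first exact: measurableC.
  rewrite Rintegral_indic_mul.
  rewrite (_ : (fun x => _) = (fun x => W x - \1_S x * W x)); last first.
    apply/funext => x; rewrite !indicE in_setC; case: (x \in S) => /=.
      by rewrite mul0r mul1r subrr.
    by rewrite mul0r mul1r subr0.
  rewrite RintegralB//; last exact: integrable_indic_mul.
  by rewrite W0 -Rintegral_indic_mul S0 subrr.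
- move=> E tE hE; have mE k : measurable (E k) by case: (hE k).
  have mU : measurable (\bigcup_k E k) by exact: bigcupT_measurable.
  split => //; rewrite /Rintegral integral_bigcup//; last exact: integrableS iW.
  rewrite eseries0// => k _ _.
  have ik : P.-integrable (E k) (EFin \o W) by exact: integrableS iW.
  rewrite -[LHS]fineK; last exact: integrable_fin_num.
  by congr EFin; case: (hE k).
Qed.

End SigmaAlgebraExtension.

Section ConditionalCylinders.
Context {R : realType} {d : measure_display} {T : measurableType d}.
Variables (P : probability T R) (F : set (set T)) (m n N : nat).
Variables (G : 'I_N -> T -> 'M[R]_(m, n)).

(** A pi-system generating the sigma-field of F together with the samples indexed by J. Samples
    outside J are left unconstrained by [setT], which keeps one index type for all J. *)
Definition cond_cylinders (J : pred 'I_N) : set (set T) :=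
  [set S | exists A (E : 'I_N -> set 'M[R]_(m, n)),
    [/\ F A, forall l, mxBorel (E l), forall l, ~~ J l -> E l = setT &
        S = A `&` \bigcap_(l in [set: 'I_N]) (G l @^-1` E l)]].

Definition cond_sigma (J : pred 'I_N) := <<s cond_cylinders J >>.

Hypothesis sF : sub_sigma F.
Hypothesis indepG : cond_indep P F G.
Variable J : pred 'I_N.

Lemma cond_cylinders_setI_closed : setI_closed (cond_cylinders J).
Proof.
move=> S S' [A [E [FA mE EJ ->]]] [A' [E' [FA' mE' EJ' ->]]].
exists (A `&` A'), (fun l => E l `&` E' l); split.
- exact: sub_sigmaI.
- by move=> l; exact: mxBorelI.
- by move=> l Jl; rewrite EJ// EJ'// setIT.
- apply/seteqP; split => x /=.
    by move=> [[a h] [a' h']]; split => // l _; split; [exact: h|exact: h'].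
  by move=> [[a a'] h]; split; split => // l _; case: (h l I).
Qed.

Lemma cond_cylinders_measurable : cond_cylinders J `<=` measurable.
Proof.
move=> S [A [E [FA mE _ ->]]]; apply: measurableI; first exact: (sub_sigma_measurable sF).
(* Measurability of the intersection is read off the integrability of its indicator, which
   [cond_indep] contains. *)
have [p [_ [_ + _ _]]] := indepG mE.
by move=> /integrable_measurable_fun/measurable_indicP.
Qed.

Lemma sub_sigma_cond_sigma : sub_sigma (cond_sigma J).
Proof.
split; first exact: smallest_sigma_algebra.
apply: smallest_sub; first exact: sigma_algebra_measurable.
exact: cond_cylinders_measurable.
Qed.

Lemma sub_cond_sigma : F `<=` cond_sigma J.
Proof.
move=> A FA; apply: sub_sigma_algebra; exists A, (fun=> setT); split => //.
  by move=> l; exact: mxBorel_setT.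
by apply/seteqP; split => x /=; [move=> h; split|case].
Qed.

Lemma Fmeas_cond_sigma_entry l a b : J l -> Fmeas (cond_sigma J) (fun x => G l x a b).
Proof.
move=> Jl e me; apply: sub_sigma_algebra.
exists setT, (fun k => if k == l then (fun M : 'M[R]_(m, n) => M a b) @^-1` e else setT).
split.
- exact: sub_sigmaT.
- by move=> k; case: eqP => _; [exact: mxBorel_entry|exact: mxBorel_setT].
- by move=> k; case: eqP => // ->; rewrite Jl.
- apply/seteqP; split => x /=.
    by move=> h; split => // k _; case: eqP => // ->.
  by move=> [_ /(_ l I)]; rewrite eqxx.
Qed.

(** Martingale difference property inside a batch: a sample not yet revealed is centred given F and
    the samples in J. It holds on cylinders, extends to the generated sigma-field, and then to
    multiplication by Z. *)
Lemma cond_sigma_orthogonal i a b (g Z : T -> R) : ~~ J i ->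
  cond_exp_version P F (fun x => G i x a b) g -> Fmeas (cond_sigma J) Z ->
  P.-integrable setT (EFin \o (fun x => Z x * (G i x a b - g x))) ->
  \int[P]_x (Z x * (G i x a b - g x)) = 0.
Proof.
move=> Ji ceG FZ iZ; have [_ iG ig _] := ceG.
have sJ := sub_sigma_cond_sigma.
have iW : P.-integrable setT (EFin \o (fun x => G i x a b - g x)) by exact: integrable_subr.
have cyl S : cond_cylinders J S -> \int[P]_(x in S) (G i x a b - g x) = 0.
  by move=> [A [E [FA mE EJ ->]]]; apply: (cond_indep_orthogonal sF indepG ceG FA mE); exact: EJ.
apply: Rintegral_mul_eq0 => //; first exact: Fmeas_measurable FZ.
move=> e me; apply: (Rintegral_eq0_g_sigma iW cond_cylinders_setI_closed cond_cylinders_measurable _ cyl).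
  apply: cyl; exists setT, (fun=> setT); split => //.
  - exact: sub_sigmaT.
  - by move=> l; exact: mxBorel_setT.
  - by apply/seteqP; split => x.
exact: FZ.
Qed.

End ConditionalCylinders.

(** * Martingale moment inequality *)

Lemma affine_step {R : realType} (s : nat) (u v t k D : R) : 0 <= k ->
  u <= v + k * (s%:R * D) -> t <= D -> u + k * t <= v + k * (s.+1%:R * D).
Proof.
move=> k0 h1 tD; rewrite -(natr1 s) mulrDl mul1r mulrDr addrA.
by apply: lerD => //; rewrite ler_wpM2l.
Qed.

Section BatchIncrement.
Context {R : realType} {d : measure_display} {T : measurableType d}.
Variables (P : probability T R) (F : set (set T)) (m n B : nat).
Variables (G : 'I_B -> T -> 'M[R]_(m, n)) (g : T -> 'M[R]_(m, n)) (alpha : R).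
Hypothesis alpha12 : 1 < alpha <= 2.
Hypothesis sF : sub_sigma F.
Hypothesis indepG : cond_indep P F G.
Hypothesis ceG : forall i a b, cond_exp_version P F (fun x => G i x a b) (fun x => g x a b).
Hypothesis iG : forall i, P.-integrable setT (EFin \o (fun x => normF (G i x - g x) `^ alpha)).

Let alpha0 : 0 < alpha. Proof. by case/andP: alpha12 => /(lt_trans ltr01). Qed.

(** Replace the smaller number by the larger one. This makes the cross term of [powR_smoothness]
    integrable when both alpha-th moments are finite. *)
Lemma mulr_powRB1_le (x y : R) : 0 <= x -> 0 <= y ->
  x `^ (alpha - 1) * y <= x `^ alpha + y `^ alpha.
Proof.
move=> x0 y0; have [yx|xy] := leP y x.
  rewrite -[x `^ alpha](mulr_powRB1 x0 alpha0) mulrC.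
  by apply: (le_trans (ler_wpM2r (powR_ge0 _ _) yx)); rewrite lerDl powR_ge0.
rewrite -[y `^ alpha](mulr_powRB1 y0 alpha0) mulrC.
apply: (@le_trans _ _ (y * y `^ (alpha - 1))); last by rewrite lerDr powR_ge0.
rewrite ler_wpM2l// ge0_ler_powR ?nnegrE ?(ltW xy)//; case/andP: alpha12; lra.
Qed.


Lemma integrable_normF_powD (Y D : T -> 'M[R]_(m, n)) (w : R) : rmx_meas Y -> rmx_meas D ->
  P.-integrable setT (EFin \o (fun x => normF (Y x) `^ alpha)) ->
  P.-integrable setT (EFin \o (fun x => normF (D x) `^ alpha)) ->
  P.-integrable setT (EFin \o (fun x => normF (Y x + w *: D x) `^ alpha)).
Proof.
move=> mY mD iY iD.
apply: (@integrable_dominated _ _ _ _ _ (fun x => (1 + alpha) * normF (Y x) `^ alpha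
   + (1 + alpha + alpha) * `|w| `^ alpha * normF (D x) `^ alpha)).
- apply: (measurableT_comp (measurable_powR alpha)); apply: measurable_normF => i j.
  under eq_fun do rewrite !mxE.
  by apply: measurable_funD => //; apply: measurable_funM => //; exact: measurable_cst.
- by apply: integrable_addr; [exact: integrable_mulrl iY|exact: integrable_mulrl iD].
- move=> x; rewrite ger0_norm ?powR_ge0//.
  have w0 : 0 <= `|w| by [].
  have := powR_smoothness (normF_ge0 (Y x)) (normF_ge0 (w *: D x)) (normF_ge0 _) alpha12
    (frob_le _ _) (normF_sqrD _ _).
  move=> /le_trans; apply.
  rewrite -[_ * `|w| `^ alpha * _]mulrA -powRM ?normF_ge0// -normFZ.
  set p := normF (Y x); set q := normF (w *: D x).
  have h : p `^ (alpha - 2) * frob (Y x) (w *: D x) <= p `^ alpha + q `^ alpha.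
    apply: le_trans (mulr_powRB1_le (normF_ge0 _) (normF_ge0 _)).
    have pE : p `^ (alpha - 1) = p * p `^ (alpha - 2).
      rewrite -(@mulr_powRB1 _ p (alpha - 1)) ?normF_ge0//; last by case/andP: alpha12; lra.
      by congr (_ * _ `^ _); lra.
    rewrite pE -/q [p * _]mulrC -mulrA ler_wpM2l ?powR_ge0//.
    exact: le_trans (ler_norm _) (frob_le _ _).
  move: (ler_wpM2l (ltW alpha0) h).
  by move: (p `^ alpha) (q `^ alpha) (p `^ (alpha - 2) * _) => u v t; lra.
Qed.

(** Integrates [powR_smoothness] against lam. The linear term is a sum over entries of a factor
    known from F and J times a centred entry of the sample i, hence has mean zero. *)
Lemma weighted_powF_increment (J : pred 'I_B) i (Y : T -> 'M[R]_(m, n)) (lam : T -> R) (c w : R) :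
  ~~ J i -> (forall a b, Fmeas (cond_sigma F G J) (fun x => Y x a b)) ->
  P.-integrable setT (EFin \o (fun x => normF (Y x) `^ alpha)) ->
  Fmeas F lam -> (forall x, 0 <= lam x <= c) ->
  \int[P]_x (lam x * normF (Y x + w *: (G i x - g x)) `^ alpha) <=
  \int[P]_x (lam x * normF (Y x) `^ alpha) +
  (1 + alpha) * `|w| `^ alpha * \int[P]_x (lam x * normF (G i x - g x) `^ alpha).
Proof.
move=> Ji FY iY Flam lamc.
have sJ := sub_sigma_cond_sigma sF indepG J.
have mY : rmx_meas Y by move=> a b; exact: Fmeas_measurable (FY a b).
have mg a b : Fmeas F (fun x => g x a b) by case: (ceG i a b).
have mD : rmx_meas (fun x => G i x - g x).
  move=> a b; under eq_fun do rewrite !mxE.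
  apply: measurable_funB; last exact: Fmeas_measurable (mg a b).
  by case: (ceG i a b) => _ /integrable_measurable_fun.
have mlam := Fmeas_measurable sF Flam.
have lamb x : `|lam x| <= c by case/andP: (lamc x) => h1 h2; rewrite ger0_norm.
have c0 : 0 <= c by exact: le_trans (lamb point).
have ilam X : P.-integrable setT (EFin \o X) ->
  P.-integrable setT (EFin \o (fun x => lam x * X x)) by exact: integrable_bounded_mul.
(* The known factor in front of the entry (a, b): the weighted gradient of |Y|^alpha, up to the
   factor alpha. *)
pose Z a b x := lam x * (normF (Y x) `^ (alpha - 2) * Y x a b).
have FZ a b : Fmeas (cond_sigma F G J) (Z a b).
  apply: (FmeasM sJ); first exact: (Fmeas_subset (@sub_cond_sigma _ _ _ _ _ _ _ G J) Flam).
  by apply: (FmeasM sJ) => //; apply: (Fmeas_powR sJ); exact: (Fmeas_normF sJ).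
have iZ a b : P.-integrable setT (EFin \o (fun x => Z a b x * (G i x a b - g x a b))).
  apply: (@integrable_dominated _ _ _ _ _ (fun x => c * (normF (Y x) `^ alpha + normF (G i x - g x) `^ alpha))).
  - apply: measurable_funM; first exact: Fmeas_measurable (FZ a b).
    by have := mD a b; under eq_fun do rewrite !mxE.
  - exact: integrable_mulrl (integrable_addr iY (iG i)).
  - move=> x; rewrite /Z -mulrA normrM; apply: ler_pM => //.
    apply: le_trans (mulr_powRB1_le (normF_ge0 _) (normF_ge0 _)).
    rewrite normrM; apply: ler_pM => //.
      rewrite normrM ger0_norm ?powR_ge0//.
      rewrite -(@mulr_powRB1 _ _ (alpha - 1)) ?normF_ge0//; last by case/andP: alpha12; lra.
      have -> : alpha - 1 - 1 = alpha - 2 by lra.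
      by rewrite mulrC ler_wpM2r ?powR_ge0// normF_entry.
    by have := normF_entry (G i x - g x) a b; rewrite !mxE.
have linE x : lam x * (normF (Y x) `^ (alpha - 2) * frob (Y x) (w *: (G i x - g x))) =
    w * \sum_a \sum_b Z a b x * (G i x a b - g x a b).
  rewrite frobZr (mulrCA _ w) (mulrCA _ w); congr (w * _).
  rewrite mulrA /frob mulr_sumr; apply: eq_bigr => a _.
  by rewrite mulr_sumr; apply: eq_bigr => b _; rewrite !mxE /Z; ring.
have isum : P.-integrable setT (EFin \o (fun x => \sum_a \sum_b Z a b x * (G i x a b - g x a b))).
  by do 2 (apply: integrable_sumr => ?); exact: iZ.
have lin0 : \int[P]_x (w * \sum_a \sum_b Z a b x * (G i x a b - g x a b)) = 0.
  rewrite RintegralZl// Rintegral_sumr; last by move=> a; apply: integrable_sumr => b; exact: iZ.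
  rewrite big1 ?mulr0// => a _; rewrite Rintegral_sumr; last by move=> b; exact: iZ.
  by rewrite big1// => b _; apply: (cond_sigma_orthogonal sF indepG Ji (ceG i a b)).
have iYl := ilam _ iY; have iDl := ilam _ (iG i).
have iYD := integrable_normF_powD w mY mD iY (iG i).
have iDl' := integrable_mulrl ((1 + alpha) * `|w| `^ alpha) iDl.
have ilin := integrable_mulrl alpha (integrable_mulrl w isum).
have lin0' : \int[P]_x (alpha * (w * \sum_a \sum_b Z a b x * (G i x a b - g x a b))) = 0.
  by rewrite (RintegralZl _ measurableT (integrable_mulrl w isum)) lin0 mulr0.
rewrite -(RintegralZl _ measurableT iDl) -(RintegralD measurableT iYl iDl').
rewrite -[leRHS]addr0 -lin0' -(RintegralD measurableT (integrable_addr iYl iDl') ilin).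
apply: (le_Rintegral measurableT (ilam _ iYD) (integrable_addr (integrable_addr iYl iDl') ilin)).
move=> x _; rewrite -linE.
have := powR_smoothness (normF_ge0 (Y x)) (normF_ge0 (w *: (G i x - g x))) (normF_ge0 _) alpha12
    (frob_le _ _) (normF_sqrD _ _).
case/andP: (lamc x) => l0 _ /(ler_wpM2l l0) /le_trans; apply.
rewrite normFZ powRM ?normF_ge0//.
move: (lam x) (normF (Y x) `^ alpha) (normF (G i x - g x) `^ alpha) (`|w| `^ alpha)
  (normF (Y x) `^ (alpha - 2) * frob _ _) => l u v z t.
by rewrite le_eqVlt; apply/orP; left; apply/eqP; ring.
Qed.

(** The samples are revealed one by one, J being the indices below s. As lam depends on F alone, the
    same weight serves for all B samples and each costs at most D. *)
Lemma weighted_powF_batch (Y : T -> 'M[R]_(m, n)) (lam : T -> R) (c w D : R) :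
  (forall a b, Fmeas F (fun x => Y x a b)) ->
  P.-integrable setT (EFin \o (fun x => normF (Y x) `^ alpha)) ->
  Fmeas F lam -> (forall x, 0 <= lam x <= c) ->
  (forall i, \int[P]_x (lam x * normF (G i x - g x) `^ alpha) <= D) ->
  P.-integrable setT (EFin \o (fun x => normF (Y x + w *: \sum_(l < B) (G l x - g x)) `^ alpha)) /\
  \int[P]_x (lam x * normF (Y x + w *: \sum_(l < B) (G l x - g x)) `^ alpha) <=
  \int[P]_x (lam x * normF (Y x) `^ alpha) + (1 + alpha) * `|w| `^ alpha * (B%:R * D).
Proof.
move=> FY iY Flam lamc hD.
pose S s x := Y x + w *: \sum_(l < B | (l < s)%N) (G l x - g x).
have FS s : (s <= B)%N -> forall a b,
    Fmeas (cond_sigma F G (fun l : 'I_B => (l < s)%N)) (fun x => S s x a b).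
  move=> sB a b; set J := fun l : 'I_B => _.
  have sJ := sub_sigma_cond_sigma sF indepG J.
  have sub := @sub_cond_sigma _ _ _ F m n B G J.
  under eq_fun do rewrite /S !mxE summxE mulr_sumr.
  apply: (FmeasD sJ); first exact: Fmeas_subset sub (FY a b).
  rewrite (_ : (fun x => _) = (fun x => \sum_(l < B) if J l then w * (G l x - g x) a b else 0)); last first.
    by apply/funext => x; exact: big_mkcond.
  apply: (Fmeas_sum sJ) => l; case Jl : (J l); last exact: (Fmeas_cst sJ).
  under eq_fun do rewrite !mxE.
  apply: (FmeasM sJ); first exact: (Fmeas_cst sJ).
  apply: (FmeasB sJ); first by apply: Fmeas_cond_sigma_entry.
  by apply: Fmeas_subset sub _; case: (ceG l a b).
have SS s (sB : (s < B)%N) x : S s.+1 x = S s x + w *: (G (Ordinal sB) x - g x).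
  rewrite /S -addrA -scalerDr; congr (_ + _ *: _).
  rewrite (bigD1 (Ordinal sB))//= addrC; congr (_ + _); apply: eq_bigl => l.
  by rewrite ltnS -val_eqE /= [in RHS]ltn_neqAle andbC.
have S0 x : S 0 x = Y x by rewrite /S big_pred0 ?scaler0 ?addr0.
have key s : (s <= B)%N ->
    P.-integrable setT (EFin \o (fun x => normF (S s x) `^ alpha)) /\
    \int[P]_x (lam x * normF (S s x) `^ alpha) <=
    \int[P]_x (lam x * normF (Y x) `^ alpha) + (1 + alpha) * `|w| `^ alpha * (s%:R * D).
  elim: s => [_|s IH sB].
    under eq_fun do rewrite S0; split => //.
    under eq_Rintegral do rewrite S0.
    by rewrite mul0r mulr0 addr0.
  have [iS leS] := IH (ltnW sB).
  have sJ := sub_sigma_cond_sigma sF indepG (fun l : 'I_B => (l < s)%N).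
  have mS : rmx_meas (S s) by move=> a b; exact: Fmeas_measurable (FS s (ltnW sB) a b).
  have mD : rmx_meas (fun x => G (Ordinal sB) x - g x).
    move=> a b; under eq_fun do rewrite !mxE.
    by case: (ceG (Ordinal sB) a b) => Fg /integrable_measurable_fun mG _ _; apply: measurable_funB => //; exact: Fmeas_measurable Fg.
  under eq_fun do rewrite (SS _ sB); split; first exact: (integrable_normF_powD w mS mD iS (iG _)).
  under eq_Rintegral do rewrite (SS _ sB).
  have Ji : ~~ ((Ordinal sB : 'I_B) < s)%N by rewrite /= ltnn.
  have k0 : 0 <= (1 + alpha) * `|w| `^ alpha.
    by rewrite mulr_ge0 ?powR_ge0// addr_ge0// ltW.
  exact: (le_trans (weighted_powF_increment w Ji (FS s (ltnW sB)) iS Flam lamc)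
                   (affine_step k0 leS (hD (Ordinal sB)))).
have SB : S B = fun x => Y x + w *: \sum_(l < B) (G l x - g x).
  by apply/funext => x; rewrite /S; congr (_ + _ *: _); apply: eq_bigl => l; rewrite ltn_ord.
by have := key B (leqnn B); rewrite SB.
Qed.

End BatchIncrement.

Lemma telescoping_step {R : realType} (k w v y y' u u' : R) : 0 <= k ->
  y' <= y + k * w * v -> y <= k * u -> w * v <= u' - u -> y' <= k * u'.
Proof.
move=> k0 h1 h2 /(ler_wpM2l k0) h3; apply: (le_trans h1).
by rewrite -mulrA; apply: (le_trans (lerD h2 h3)); rewrite mulrBr addrC subrK.
Qed.

(** * Self-normalised bound for weighted noise sums *)

Section PredictableVariation.
Context {R : realType} {d : measure_display} {T : measurableType d}.
Variables (P : probability T R) (F : nat -> set (set T)) (m n B : nat).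
Variables (G : nat -> 'I_B -> T -> 'M[R]_(m, n)) (g : nat -> T -> 'M[R]_(m, n)).
Variables (V : nat -> T -> R) (alpha : R) (c : nat -> R).

Definition batch_noise k x := (B%:R)^-1 *: \sum_(l < B) (G k l x - g k x).

Definition noise_sum k x := \sum_(j < k) c j *: batch_noise j x.

(** The factor B * B^(-alpha) accounts for B samples, each scaled by 1/B. The floor eps keeps
    negative powers bounded. *)
Definition variation (eps : R) k x :=
  eps + \sum_(j < k) `|c j| `^ alpha * (B%:R * (B%:R)^-1 `^ alpha) * V j x.

Hypothesis alpha12 : 1 < alpha <= 2.
Hypothesis filtF : filtration F.
Hypothesis FG : forall k l a b, Fmeas (F k.+1) (fun x => G k l x a b).
Hypothesis indepG : forall k, cond_indep P (F k) (G k).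
Hypothesis ceG : forall k l a b,
  cond_exp_version P (F k) (fun x => G k l x a b) (fun x => g k x a b).
Hypothesis Fg : forall k a b, Fmeas (F k) (fun x => g k x a b).
Hypothesis iG : forall k l, P.-integrable setT (EFin \o (fun x => normF (G k l x - g k x) `^ alpha)).
Hypothesis FV : forall k, Fmeas (F k) (V k).
Hypothesis V0 : forall k x, 0 <= V k x.
Hypothesis Vb : forall k, exists v, forall x, V k x <= v.
Hypothesis momentG : forall k l (lam : T -> R) e, Fmeas (F k) lam -> (forall x, 0 <= lam x <= e) ->
  \int[P]_x (lam x * normF (G k l x - g k x) `^ alpha) <= \int[P]_x (lam x * V k x).

Let alpha1 : 1 < alpha. Proof. by case/andP: alpha12. Qed.
Let alpha0 : 0 < alpha. Proof. exact: lt_trans alpha1. Qed.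
Let s01 : 0 < alpha^-1 <= 1. Proof. by rewrite invr_gt0 alpha0/= invf_le1// ltW. Qed.
Let s0 : alpha^-1 - 1 <= 0. Proof. by rewrite subr_le0; case/andP: s01. Qed.

Let sF k : sub_sigma (F k). Proof. by case: filtF. Qed.

Lemma filtration_le j k : (j <= k)%N -> F j `<=` F k.
Proof.
elim: k => [|k IH]; first by rewrite leqn0 => /eqP ->.
rewrite leq_eqVlt => /predU1P[->//|]; rewrite ltnS => /IH h A /h; case: filtF => _; exact.
Qed.

Lemma integrable_bounded (f : T -> R) e : measurable_fun setT f -> (forall x, `|f x| <= e) ->
  P.-integrable setT (EFin \o f).
Proof. by move=> mf fe; exact: (integrable_dominated mf (integrable_constant P e) fe). Qed.

Lemma noise_sumS k : noise_sum k.+1 =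
  fun x => noise_sum k x + (c k * (B%:R)^-1) *: \sum_(l < B) (G k l x - g k x).
Proof. by apply/funext => x; rewrite /noise_sum big_ord_recr /= /batch_noise scalerA. Qed.

Lemma Fmeas_batch_noise k a b : Fmeas (F k.+1) (fun x => batch_noise k x a b).
Proof.
under eq_fun do rewrite /batch_noise mxE summxE.
apply: (FmeasM (sF k.+1)); first exact: (Fmeas_cst (sF k.+1)).
apply: (Fmeas_sum (sF k.+1)) => l.
under eq_fun do rewrite !mxE.
apply: (FmeasB (sF k.+1)); first exact: FG.
exact: (Fmeas_subset (filtration_le (leqnSn k)) (Fg k a b)).
Qed.

Lemma Fmeas_noise_sum k a b : Fmeas (F k) (fun x => noise_sum k x a b).
Proof.
under eq_fun do rewrite /noise_sum summxE.
apply: (Fmeas_sum (sF k)) => j.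
under eq_fun do rewrite mxE.
apply: (FmeasM (sF k)); first exact: (Fmeas_cst (sF k)).
exact: (Fmeas_subset (filtration_le (ltn_ord j)) (Fmeas_batch_noise j a b)).
Qed.

Section Variation.
Variable eps : R.
Hypothesis eps0 : 0 < eps.

Lemma variation_ge k x : eps <= variation eps k x.
Proof. by rewrite lerDl sumr_ge0// => j _; rewrite !mulr_ge0 ?powR_ge0 ?ler0n. Qed.

Lemma variation_gt0 k x : 0 < variation eps k x.
Proof. exact: lt_le_trans (variation_ge k x). Qed.

Lemma variationS k x : variation eps k.+1 x =
  variation eps k x + `|c k| `^ alpha * (B%:R * (B%:R)^-1 `^ alpha) * V k x.
Proof. by rewrite /variation big_ord_recr /= addrA. Qed.

Lemma variation_leS k x : variation eps k x <= variation eps k.+1 x.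
Proof. by rewrite variationS lerDl !mulr_ge0 ?powR_ge0 ?ler0n. Qed.

(** Predictability: only V_0, ..., V_k enter, so the weight at k + 1 is already known before the
    noise of iteration k is drawn. *)
Lemma Fmeas_variationS k : Fmeas (F k) (variation eps k.+1).
Proof.
apply: (FmeasD (sF k)); first exact: (Fmeas_cst (sF k)).
apply: (Fmeas_sum (sF k)) => j; apply: (FmeasM (sF k)); first exact: (Fmeas_cst (sF k)).
by apply: (Fmeas_subset (filtration_le _) (FV j)); rewrite -ltnS.
Qed.

Lemma measurable_variation k : measurable_fun setT (variation eps k).
Proof.
case: k => [|k]; last exact: (Fmeas_measurable (sF k) (Fmeas_variationS k)).
by rewrite (_ : variation eps 0 = fun=> eps)//; apply/funext => x; rewrite /variation big_ord0 addr0.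
Qed.

Lemma variation_bounded k : exists v, forall x, variation eps k x <= v.
Proof.
elim: k => [|k [v hv]]; first by exists eps => x; rewrite /variation big_ord0 addr0.
have [w hw] := Vb k; exists (v + `|c k| `^ alpha * (B%:R * (B%:R)^-1 `^ alpha) * w) => x.
by rewrite variationS lerD// ler_wpM2l// !mulr_ge0 ?powR_ge0 ?ler0n.
Qed.

Lemma integrable_variation_powR k :
  P.-integrable setT (EFin \o (fun x => variation eps k x `^ alpha^-1)).
Proof.
have [v hv] := variation_bounded k.
apply: (@integrable_bounded _ (v `^ alpha^-1)).
  exact: (measurableT_comp (measurable_powR alpha^-1) (measurable_variation k)).
move=> x; rewrite ger0_norm ?powR_ge0// ge0_ler_powR ?nnegrE ?invr_ge0 ?(ltW alpha0)//.
  exact: ltW (variation_gt0 k x).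
exact: le_trans (ltW (variation_gt0 k x)) (hv x).
Qed.

Definition variation_weight k x := variation eps k x `^ (alpha^-1 - 1).

Lemma variation_weight_bounded k x : 0 <= variation_weight k x <= eps `^ (alpha^-1 - 1).
Proof. by rewrite powR_ge0 powR_antitone// eps0 variation_ge. Qed.

Lemma variation_weight_decreasing k x : variation_weight k.+1 x <= variation_weight k x.
Proof. by rewrite powR_antitone// variation_gt0 variation_leS. Qed.

Lemma integrable_weight_mul k X : P.-integrable setT (EFin \o X) ->
  P.-integrable setT (EFin \o (fun x => variation_weight k x * X x)).
Proof.
apply: (@integrable_bounded_mul _ _ _ _ (eps `^ (alpha^-1 - 1))).
  exact: (measurableT_comp (measurable_powR (alpha^-1 - 1)) (measurable_variation k)).
by move=> x; have /andP[h1 h2] := variation_weight_bounded k x; rewrite ger0_norm.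
Qed.

(** The tangent of the concave function t^(1/alpha) at the new value A_(k+1), evaluated at A_k.
    Touching at the new value is what produces the predictable weight of index k + 1. *)
Lemma variation_weight_increment k x :
  variation_weight k.+1 x * (`|c k| `^ alpha * (B%:R * (B%:R)^-1 `^ alpha) * V k x) <=
  alpha * (variation eps k.+1 x `^ alpha^-1 - variation eps k x `^ alpha^-1).
Proof.
have := powR_le_tangent (variation_gt0 k.+1 x) (ltW (variation_gt0 k x)) s01.
rewrite -/(variation_weight k.+1 x) variationS => /(ler_wpM2l (ltW alpha0)).
set p := _ * V k x; set w := variation_weight _ _.
set u := _ `^ _; set v := _ `^ _; rewrite opprD addNKr.
have -> : alpha * (v + alpha^-1 * w * - p) = alpha * v - w * p.
  by field; exact: lt0r_neq0.
lra.
Qed.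

Let D k := \int[P]_x (variation_weight k.+1 x * V k x).

Let iV k : P.-integrable setT (EFin \o V k).
Proof.
have [v hv] := Vb k; apply: (@integrable_bounded _ v); first exact: (Fmeas_measurable (sF k) (FV k)).
by move=> x; rewrite ger0_norm.
Qed.

Lemma variation_weight_D k : `|c k * (B%:R)^-1| `^ alpha * (B%:R * D k) <=
  alpha * \int[P]_x variation eps k.+1 x `^ alpha^-1 - alpha * \int[P]_x variation eps k x `^ alpha^-1.
Proof.
rewrite normrM [`|_^-1|]ger0_norm ?invr_ge0 ?ler0n// powRM ?invr_ge0 ?ler0n//.
have -> : `|c k| `^ alpha * (B%:R)^-1 `^ alpha * (B%:R * D k) =
    `|c k| `^ alpha * (B%:R * (B%:R)^-1 `^ alpha) * D k by rewrite -!mulrA; congr (_ * _); rewrite mulrCA.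
have iWV := integrable_weight_mul k.+1 (iV k).
have i1 := integrable_variation_powR k.+1; have i0 := integrable_variation_powR k.
rewrite -mulrBr -(RintegralB measurableT i1 i0) -(RintegralZl _ measurableT iWV).
rewrite -(RintegralZl alpha measurableT (integrable_subr i1 i0)).
apply: (le_Rintegral measurableT (integrable_mulrl _ iWV) (integrable_mulrl alpha (integrable_subr i1 i0))).
by move=> x _; rewrite (le_trans _ (variation_weight_increment k x))// mulrCA.
Qed.

(** In each step the weight first drops from index k to k + 1, which only lowers the old term; then
    the batch inequality applies with that weight, and its cost telescopes. Integrability is carried
    along because the batch inequality asks for it. *)
Lemma weighted_noise_sum k :
  P.-integrable setT (EFin \o (fun x => normF (noise_sum k x) `^ alpha)) /\
  \int[P]_x (variation_weight k x * normF (noise_sum k x) `^ alpha) <=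
  (1 + alpha) * (alpha * \int[P]_x variation eps k x `^ alpha^-1).
Proof.
elim: k => [|k [iS leS]].
  have S0 : (fun x => normF (noise_sum 0 x) `^ alpha) = fun=> 0.
    by apply/funext => x; rewrite /noise_sum big_ord0 normF0 powR0// gt_eqF.
  rewrite S0; split; first exact: integrable_constant.
  rewrite (_ : (fun x => variation_weight 0 x * _) = fun=> 0); last first.
    apply/funext => x; have := congr1 (fun f => f x) S0 => /= ->.
    by rewrite mulr0.
  rewrite Rintegral_cst// mul0r !mulr_ge0 ?addr_ge0 ?(ltW alpha0)//.
  by apply: Rintegral_ge0 => x _; exact: powR_ge0.
have FW : Fmeas (F k) (variation_weight k.+1) by exact: (Fmeas_powR (sF k) _ (Fmeas_variationS k)).
have [i1 le1] := weighted_powF_batch alpha12 (sF k) (indepG k) (ceG k) (iG k) (c k * (B%:R)^-1)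
  (Fmeas_noise_sum k) iS FW (variation_weight_bounded k.+1)
  (fun l => momentG l FW (variation_weight_bounded k.+1)).
rewrite noise_sumS; split; first exact: i1.
have le2 : \int[P]_x (variation_weight k.+1 x * normF (noise_sum k x) `^ alpha) <=
    \int[P]_x (variation_weight k x * normF (noise_sum k x) `^ alpha).
  apply: (le_Rintegral measurableT (integrable_weight_mul k.+1 iS) (integrable_weight_mul k iS)).
  by move=> x _; rewrite ler_wpM2r ?powR_ge0// variation_weight_decreasing.
have a10 : 0 <= 1 + alpha by rewrite addr_ge0// ltW.
exact: (telescoping_step a10 le1 (le_trans le2 leS) (variation_weight_D k)).
Qed.

Lemma integrable_normF_noise_sum k :
  P.-integrable setT (EFin \o (fun x => normF (noise_sum k x))).
Proof.
have [iS _] := weighted_noise_sum k.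
apply: (integrable_dominated _ (integrable_addr (integrable_constant P 1) iS)).
  by apply: measurable_normF => a b; exact: (Fmeas_measurable (sF k) (Fmeas_noise_sum k a b)).
move=> x; rewrite ger0_norm ?normF_ge0//.
have [h|h] := leP (normF (noise_sum k x)) 1; first by rewrite (le_trans h)// lerDl powR_ge0.
by rewrite (le_trans (le1r_powR (ltW h) (ltW alpha1)))// lerDr.
Qed.

Lemma expected_noise_sum_variation k :
  \int[P]_x normF (noise_sum k x) <= 2 * Num.sqrt pi * \int[P]_x variation eps k x `^ alpha^-1.
Proof.
have [iS leS] := weighted_noise_sum k.
have iW := integrable_weight_mul k iS; have iA := integrable_variation_powR k.
pose I := \int[P]_x variation eps k x `^ alpha^-1.
have I0 : 0 <= I by apply: Rintegral_ge0 => x _; exact: powR_ge0.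
have i1 := integrable_mulrl (alpha^-1 * 2 `^ (1 - alpha)) iW.
have i2 := integrable_mulrl ((1 - alpha^-1) * 2) iA.
have le1 : \int[P]_x normF (noise_sum k x) <=
    alpha^-1 * 2 `^ (1 - alpha) * \int[P]_x (variation_weight k x * normF (noise_sum k x) `^ alpha)
    + (1 - alpha^-1) * 2 * I.
  rewrite -(RintegralZl _ measurableT iW) -(RintegralZl _ measurableT iA) -(RintegralD measurableT i1 i2).
  apply: (le_Rintegral measurableT (integrable_normF_noise_sum k) (integrable_addr i1 i2)) => x _.
  have A0 := variation_gt0 k x.
  (* With l = 2 A^(1/alpha), the factor l^(1 - alpha) in Young's inequality is 2^(1 - alpha) times
     exactly [variation_weight]. *)
  have l0 : 0 < 2 * variation eps k x `^ alpha^-1 by rewrite mulr_gt0// powR_gt0.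
  apply: (le_trans (young_powR (normF_ge0 (noise_sum k x)) l0 (ltW alpha1))).
  rewrite powRM ?powR_ge0// -powRrM.
  have -> : alpha^-1 * (1 - alpha) = alpha^-1 - 1.
    by rewrite mulrBr mulr1 mulVf// gt_eqF.
  rewrite -/(variation_weight k x).
  move: (variation_weight k x) (normF _ `^ alpha) (_ `^ alpha^-1) (2 `^ _) => w t v u.
  by rewrite le_eqVlt; apply/orP; left; apply/eqP; ring.
apply: (le_trans le1); apply: (@le_trans _ _ (((1 + alpha) * 2 `^ (1 - alpha) + (1 - alpha^-1) * 2) * I)).
  rewrite [leRHS]mulrDl lerD2r.
  have k0 : 0 <= alpha^-1 * 2 `^ (1 - alpha) by rewrite mulr_ge0 ?powR_ge0 ?invr_ge0 ?(ltW alpha0).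
  apply: (le_trans (ler_wpM2l k0 leS)).
  have -> : alpha^-1 * 2 `^ (1 - alpha) * ((1 + alpha) * (alpha * I)) =
     (alpha^-1 * alpha) * ((1 + alpha) * 2 `^ (1 - alpha) * I) by ring.
  by rewrite mulVf ?mul1r// gt_eqF.
by rewrite ler_wpM2r// martingale_constant_le.
Qed.

End Variation.

(** Removes the floor: eps is chosen with 2 sqrt(pi) eps^(1/alpha) = e for an arbitrary e > 0, and
    subadditivity of the root splits it off. *)
Lemma expected_noise_sum k : \int[P]_x normF (noise_sum k x) <=
  2 * Num.sqrt pi * \int[P]_x variation 0 k x `^ alpha^-1.
Proof.
have v0 x : 0 <= variation 0 k x by rewrite /variation add0r sumr_ge0// => j _; rewrite !mulr_ge0 ?powR_ge0 ?ler0n.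
have sp : 0 < 2 * Num.sqrt (pi : R) by rewrite mulr_gt0// sqrtr_gt0 pi_gt0.
apply/ler_addgt0Pr => e e0.
have e'0 : 0 < e / (2 * Num.sqrt pi) by rewrite divr_gt0.
pose eps := (e / (2 * Num.sqrt (pi : R))) `^ alpha.
have eps0 : 0 < eps by rewrite powR_gt0.
have epsE : eps `^ alpha^-1 = e / (2 * Num.sqrt pi).
  by rewrite -powRrM mulfV ?powRr1// ?(ltW e'0)// gt_eqF.
have vE x : variation eps k x = eps + variation 0 k x by rewrite /variation add0r.
have iv : P.-integrable setT (EFin \o (fun x => variation 0 k x `^ alpha^-1)).
  apply: (integrable_dominated _ (integrable_variation_powR eps0 k)).
    apply: (measurableT_comp (measurable_powR alpha^-1)); exact: (measurable_variation 0 k).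
  move=> x; rewrite ger0_norm ?powR_ge0// ge0_ler_powR ?nnegrE ?invr_ge0 ?(ltW alpha0)//.
    by rewrite vE addr_ge0// ltW.
  by rewrite vE lerDr ltW.
apply: (le_trans (expected_noise_sum_variation eps0 k)).
have ic := integrable_constant P (e / (2 * Num.sqrt pi)).
have le : \int[P]_x variation eps k x `^ alpha^-1 <=
    e / (2 * Num.sqrt pi) + \int[P]_x variation 0 k x `^ alpha^-1.
  have -> : e / (2 * Num.sqrt pi) = \int[P]_x (e / (2 * Num.sqrt pi)).
    by rewrite Rintegral_constant.
  rewrite -(RintegralD measurableT ic iv).
  apply: (le_Rintegral measurableT (integrable_variation_powR eps0 k) (integrable_addr ic iv)) => x _.
  by rewrite vE (le_trans (powR_subadditive (ltW eps0) (v0 x) s01))// epsE.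
apply: (le_trans (ler_wpM2l (ltW sp) le)).
by rewrite mulrDr addrC [_ * (e / _)]mulrC divfK// gt_eqF.
Qed.

End PredictableVariation.

(** * Moments and weights of the momentum noise *)

Section HeavyTailedMoments.
Context {R : realType} {d : measure_display} {T : measurableType d}.
Variables (P : probability T R) (F : set (set T)) (X Y V : T -> R) (v : R).
Hypothesis sF : sub_sigma F.
Hypothesis ceX : ncond_exp_version P F X Y.
Hypothesis YV : {ae P, forall x, Y x <= V x}.
Hypothesis FV : Fmeas F V.
Hypothesis V0v : forall x, 0 <= V x <= v.
Hypothesis mX : measurable_fun setT X.
Hypothesis X0 : forall x, 0 <= X x.

Let mV : measurable_fun setT V. Proof. exact: (Fmeas_measurable sF FV). Qed.

Let iV : P.-integrable setT (EFin \o V).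
Proof.
apply: (integrable_dominated mV (integrable_constant P v)) => x.
by case/andP: (V0v x) => h1 h2; rewrite ger0_norm.
Qed.

Let iY : P.-integrable setT (EFin \o Y).
Proof.
case: ceX => FY Y0 _; apply: (integrable_ae_dominated (Fmeas_measurable sF FY) iV).
by apply: filterS YV => x h; rewrite ger0_norm.
Qed.

(** X has the same integral as Y, and Y is almost everywhere below the bounded V. *)
Lemma ncond_exp_integrable : P.-integrable setT (EFin \o X).
Proof.
case: ceX => FY Y0 /(_ setT (sub_sigmaT sF)) XY.
apply/integrableP; split; first exact/measurable_EFinP.
have -> : (\int[P]_x `|(EFin \o X) x| = \int[P]_x (X x)%:E)%E.
  by apply: eq_integral => x _; rewrite /= ger0_norm.
by rewrite XY ltey_eq (integrable_fin_num measurableT iY).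
Qed.

Lemma ncond_exp_mul_le (lam : T -> R) e : Fmeas F lam -> (forall x, 0 <= lam x <= e) ->
  \int[P]_x (lam x * X x) <= \int[P]_x (lam x * V x).
Proof.
move=> Flam lame; case: (ceX) => FY Y0 XY.
have mlam := Fmeas_measurable sF Flam.
have lamb x : `|lam x| <= e by case/andP: (lame x) => h1 h2; rewrite ger0_norm.
have il Z := @integrable_bounded_mul _ _ _ P e _ Z mlam lamb.
have ce : cond_exp_version P F X Y by split => //; exact: ncond_exp_integrable.
rewrite (cond_exp_mul sF ce Flam (il _ ncond_exp_integrable) (il _ iY)).
apply: (ae_le_Rintegral (il _ iY) (il _ iV)); apply: filterS YV => x h.
by rewrite ler_wpM2l//; case/andP: (lame x).
Qed.

End HeavyTailedMoments.

Section MomentumWeights.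
Context {R : realType}.
Variables (alpha beta : R).
Hypothesis alpha12 : 1 < alpha <= 2.
Hypothesis beta01 : 0 < beta < 1.

Let b0 : 0 < beta. Proof. by case/andP: beta01. Qed.
Let b1 : beta < 1. Proof. by case/andP: beta01. Qed.
Let c0 : 0 < 1 - beta. Proof. by rewrite subr_gt0. Qed.
Let a1 : 1 < alpha. Proof. by case/andP: alpha12. Qed.
Let a0 : 0 < alpha. Proof. exact: lt_trans a1. Qed.

(* Coefficient of the j-th batch noise in S_k - beta^k S_0; the entries at [j = 0] are exceptional
   because S_0 already contains the noise of iteration 0. *)
Definition momentum_weight (k j : nat) : R :=
  if j == 0 then (if k == 0 then 0 else - (beta ^+ k * (1 - beta)))
  else if (k < j)%N then 0
  else if j == k then 1 - beta ^+ 2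
  else beta ^+ (k - j).+1 * (1 - beta).

Lemma momentum_weightS_lt k j : (j < k)%N ->
  momentum_weight k.+1 j = beta * momentum_weight k j.
Proof.
move=> jk; rewrite /momentum_weight.
have k0 : (k == 0)%N = false by apply/eqP => k0; rewrite k0 in jk.
case: eqP => [_|j0]; first by rewrite /= k0 exprS; ring.
rewrite ltnNge (leqW (ltnW jk))/= ltnNge (ltnW jk)/= ltn_eqF ?ltnS ?(ltnW jk)// ltn_eqF//.
by rewrite subSn ?(ltnW jk)// [in LHS]exprS mulrA.
Qed.

(** The recursion for S_(k+1) subtracts beta (1 - beta) times the noise of iteration k. For k > 0
    this turns beta (1 - beta^2) into beta^2 (1 - beta); for k = 0 it creates the negative
    weight. *)
Lemma momentum_weightS_eq k :
  momentum_weight k.+1 k = beta * momentum_weight k k - beta * (1 - beta).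
Proof.
rewrite /momentum_weight; case: k => [|k]; first by rewrite /= expr1; ring.
by rewrite /= ltnn ltnNge leqnSn/= eqxx ltn_eqF// subSnn; ring.
Qed.

Lemma momentum_weight_diag k : momentum_weight k.+1 k.+1 = 1 - beta ^+ 2.
Proof. by rewrite /momentum_weight /= ltnn eqxx. Qed.

Lemma momentum_weight_subdiag_le k : `|momentum_weight k.+1 k| <= 1 - beta.
Proof.
rewrite /momentum_weight; case: k => [|k] /=.
  by rewrite expr1 normrN ger0_norm ?mulr_ge0 ?(ltW b0) ?(ltW c0)// ler_piMl ?(ltW c0) ?(ltW b1).
rewrite ltnNge leqnSn/= ltn_eqF// subSnn.
rewrite ger0_norm ?mulr_ge0 ?exprn_ge0 ?(ltW b0) ?(ltW c0)// ler_piMl ?(ltW c0)//.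
by rewrite exprn_ile1 ?(ltW b0) ?(ltW b1).
Qed.

(** The sums satisfy u_(k+1) <= beta u_k + (1 - beta)^alpha, and the bound is the fixed point of
    this recursion. *)
Lemma momentum_weight_offdiag_powR k :
  \sum_(j < k) `|momentum_weight k j| `^ alpha <= (1 - beta) `^ (alpha - 1).
Proof.
elim: k => [|k IH]; first by rewrite big_ord0 powR_ge0.
rewrite big_ord_recr /=.
have -> : \sum_(i < k) `|momentum_weight k.+1 i| `^ alpha =
    beta `^ alpha * \sum_(i < k) `|momentum_weight k i| `^ alpha.
  rewrite mulr_sumr; apply: eq_bigr => i _.
  by rewrite momentum_weightS_lt// normrM powRM// ger0_norm// ltW.
have h1 : `|momentum_weight k.+1 k| `^ alpha <= (1 - beta) `^ alpha.
  by rewrite ge0_ler_powR ?nnegrE ?(ltW a0) ?(ltW c0)// momentum_weight_subdiag_le.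
have h2 : (1 - beta) `^ alpha = (1 - beta) * (1 - beta) `^ (alpha - 1).
  by rewrite mulr_powRB1// ltW.
have h3 : beta `^ alpha <= beta by rewrite ge1r_powR ?(ltW a1)// b0 ltW.
have u0 := powR_ge0 (1 - beta) (alpha - 1).
apply: (le_trans (lerD (ler_wpM2l (powR_ge0 beta alpha) IH) h1)); rewrite h2 -mulrDl.
by rewrite ler_piMl//; lra.
Qed.

(** Origin of Gamma_alpha: the diagonal weight 1 - beta^2 <= 2 (1 - beta) contributes the 2^alpha,
    all older weights together the 1. *)
Lemma momentum_weight_powR k :
  \sum_(j < k.+1) `|momentum_weight k j| `^ alpha <= (2 `^ alpha + 1) * (1 - beta) `^ (alpha - 1).
Proof.
rewrite big_ord_recr /= mulrDl mul1r addrC; apply: lerD; last exact: momentum_weight_offdiag_powR.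
have le : `|momentum_weight k k| <= 2 * (1 - beta).
  case: k => [|k]; first by rewrite /momentum_weight /= normr0 mulr_ge0// ltW.
  rewrite momentum_weight_diag ger0_norm ?subr_ge0 ?exprn_ile1 ?(ltW b0) ?(ltW b1)//.
  have -> : 1 - beta ^+ 2 = (1 + beta) * (1 - beta) by ring.
  by rewrite ler_wpM2r ?(ltW c0)//; have := b1; lra.
apply: (@le_trans _ _ ((2 * (1 - beta)) `^ alpha)).
  by rewrite ge0_ler_powR ?nnegrE ?mulr_ge0 ?(ltW a0) ?(ltW c0).
rewrite powRM ?(ltW c0)// ler_wpM2l ?powR_ge0// ger_powR ?c0//=; first by have := b0; lra.
by have := a0; lra.
Qed.

(** Geometric sums: beta - beta^K for the column 0 with K > 0, and 1 minus a power of beta for a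
    later column once its diagonal is reached. The bound 1 lets each expected gradient norm count
    once, as rho requires. *)
Lemma momentum_weight_column K j : \sum_(k < K) `|momentum_weight k j| <= 1.
Proof.
case: j => [|j].
  have h : forall n, \sum_(k < n.+1) `|momentum_weight k 0| = beta - beta ^+ n.+1.
    elim=> [|n IH]; first by rewrite big_ord1 /momentum_weight /= normr0 expr1 subrr.
    rewrite big_ord_recr IH /momentum_weight /= normrN ger0_norm; first by rewrite [in RHS]exprS; ring.
    by rewrite mulr_ge0 ?exprn_ge0 ?(ltW b0) ?(ltW c0).
  case: K => [|K]; first by rewrite big_ord0.
  by rewrite h lerBlDr (le_trans (ltW b1))// lerDl exprn_ge0// ltW.
have z k : (k <= j)%N -> `|momentum_weight k j.+1| = 0.
  by move=> kj; rewrite /momentum_weight /= ltnS kj normr0.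
have h : forall t, \sum_(k < t + j.+2) `|momentum_weight k j.+1| = 1 - beta ^+ t.+2.
  elim=> [|t IH].
    rewrite add0n big_ord_recr /= momentum_weight_diag big1 ?add0r.
      by rewrite ger0_norm// subr_ge0 exprn_ile1 ?(ltW b0) ?(ltW b1).
    by move=> k _; rewrite z// -ltnS.
  rewrite addSn big_ord_recr IH /momentum_weight /=.
  have lt : (j.+1 < t + j.+2)%N by rewrite leq_addl.
  rewrite ltnNge (ltnW lt) (ltn_eqF lt) -addSnnS addnK /=.
  rewrite ger0_norm; first by rewrite [in RHS]exprS; ring.
  by rewrite mulr_ge0 ?exprn_ge0 ?(ltW b0) ?(ltW c0).
have [Kj|jK] := leqP K j.+1.
  by rewrite big1// => k _; rewrite z// -ltnS (leq_trans (ltn_ord k)).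
rewrite -(subnK jK) h lerBlDr lerDl exprn_ge0// ltW//.
Qed.

End MomentumWeights.

(** The sigma0 terms stay under a common root, which keeps the gain (1 - beta)^((alpha - 1)/alpha),
    whereas the sigma1 terms are rooted one by one so that the t_j enter linearly. *)
Lemma weighted_moment_root_le {R : realType} (k : nat) (alpha b s0 s1 : R) (c t : nat -> R) :
  1 <= alpha -> 0 <= b -> 0 <= s0 -> 0 <= s1 -> (forall j, 0 <= t j) ->
  (\sum_(j < k) `|c j| `^ alpha * b * (s0 `^ alpha + s1 `^ alpha * t j `^ alpha)) `^ alpha^-1 <=
  b `^ alpha^-1 * ((\sum_(j < k) `|c j| `^ alpha) `^ alpha^-1 * s0 + s1 * \sum_(j < k) `|c j| * t j).
Proof.
move=> a1 b0 s00 s10 t0.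
have a0 : 0 < alpha by lra.
have s01 : 0 < alpha^-1 <= 1 by rewrite invr_gt0 a0/= invf_le1.
have root x : 0 <= x -> (x `^ alpha) `^ alpha^-1 = x.
  by move=> x0; rewrite -powRrM mulfV ?powRr1// gt_eqF.
have sum0 : 0 <= \sum_(j < k) `|c j| `^ alpha by apply: sumr_ge0 => j _; exact: powR_ge0.
have -> : \sum_(j < k) `|c j| `^ alpha * b * (s0 `^ alpha + s1 `^ alpha * t j `^ alpha) =
    b * ((\sum_(j < k) `|c j| `^ alpha) * s0 `^ alpha + \sum_(j < k) (s1 * (`|c j| * t j)) `^ alpha).
  rewrite mulr_suml -big_split mulr_sumr; apply: eq_bigr => j _ /=.
  by rewrite !powRM ?mulr_ge0//; ring.
have S0 : 0 <= \sum_(j < k) (s1 * (`|c j| * t j)) `^ alpha by apply: sumr_ge0 => j _; exact: powR_ge0.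
rewrite powRM ?addr_ge0 ?mulr_ge0 ?powR_ge0// ler_wpM2l ?powR_ge0//.
apply: (le_trans (powR_subadditive _ _ s01)) => //; first by rewrite mulr_ge0 ?powR_ge0.
apply: lerD; first by rewrite powRM ?powR_ge0// root.
apply: (le_trans (powR_sum_le _ _ s01)) => [j|]; first exact: powR_ge0.
by rewrite mulr_sumr; apply: ler_sum => j _; rewrite root// !mulr_ge0.
Qed.

Lemma batch_factor_root {R : realType} (B : nat) (alpha : R) : (0 < B)%N -> 1 <= alpha ->
  (B%:R * (B%:R)^-1 `^ alpha) `^ alpha^-1 = ((B%:R : R) `^ ((alpha - 1) / alpha))^-1.
Proof.
move=> B0 a1; have a0 : 0 < alpha by lra.
have b0 : 0 < B%:R :> R by rewrite ltr0n.
rewrite powRM ?powR_ge0 ?ler0n// -powRrM mulfV ?gt_eqF// powRr1 ?invr_ge0 ?ler0n//.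
rewrite -powRN -[X in _ * X]powR_inv1 ?ler0n// -powRD; last by apply/implyP => _; rewrite gt_eqF.
by congr (_ `^ _); field; rewrite gt_eqF.
Qed.

(* Tested on a single Rademacher variable. *)
Lemma vBE_constant_ge1 {R : realType} (alpha C : R) : vBE_constant alpha C -> 1 <= C.
Proof.
have half01 : 0 <= (2^-1 : R) <= 1 by rewrite invr_ge0 ler0n/= invf_le1 ?ler1n.
pose P : probability bool R := bernoulli_prob (2^-1 : R).
pose Y (k : 'I_1) (x : bool) : 'rV[R]_1 := const_mx (if x then 1 else -1).
have nY x : normF (Y ord0 x) = 1.
  by rewrite /normF /frob !big_ord1 !mxE; case: x; rewrite ?mulrNN mulr1 sqrtr1.
have intc : (\int[P]_x ((normF (Y ord0 x)) `^ alpha)%:E = 1)%E.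
  under eq_integral do rewrite nY powR1.
  by rewrite integral_cst//= probability_setT mule1.
have YE k x : Y k x = Y ord0 x by rewrite (ord1 k).
have mb (S : set bool) : measurable S by [].
have mf (f : bool -> R) : measurable_fun setT f by move=> _ E mE; exact: mb.
have iY (f : bool -> R) : P.-integrable setT (EFin \o f).
  apply: (integrable_dominated (mf f) (integrable_constant P (`|f true| + `|f false|))).
  by case; rewrite ?lerDl ?lerDr.
have Y0 (f : bool -> R) : f true = 1 -> f false = -1 -> (\int[P]_x (f x)%:E = 0)%E.
  move=> ft ff; rewrite -(fineK (integrable_fin_num measurableT (iY f))); congr EFin.
  transitivity (\int[P]_x (f x + 1 - 1)); first by apply: eq_Rintegral => x _; rewrite addrK.
  rewrite (RintegralB measurableT (iY _) (iY _)) Rintegral_constant.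
  rewrite /Rintegral (integral_bernoulli_prob half01); last first.
    by case; rewrite lee_fin ?ft ?ff ?addNr ?addr_ge0.
  by rewrite ft ff addNr mule0 adde0 /=; lra.
have eS : (fun x => ((normF (\sum_(k < 1) Y k x)) `^ alpha)%:E) =
    (fun x => ((normF (Y ord0 x)) `^ alpha)%:E) by apply/funext => x; rewrite big_ord1.
have mY : forall k, rmx_meas (Y k) by move=> k i j; exact: mf.
have indepY : mutual_indep P Y.
  move=> E mE; rewrite big_ord1; congr (P _); apply/seteqP; split => x /=.
    by move=> /(_ ord0 I).
  by move=> hx k _; rewrite (ord1 k).
have centeredY : forall k i j, P.-integrable setT (fun x => (Y k x i j)%:E) /\
    (\int[P]_x (Y k x i j)%:E = 0)%E.
  by move=> k i j; split; [exact: iY|apply: Y0; rewrite mxE].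
have momentY : forall k, (\int[P]_x ((normF (Y k x)) `^ alpha)%:E < +oo)%E.
  by move=> k; rewrite (ord1 k) intc ltry.
move=> h; have := h _ bool P 1 1 Y mY indepY centeredY momentY.
by rewrite eS big_ord1 intc mule1 lee_fin.
Qed.

(** * Muon trajectories *)

Section Trajectory.
Context {R : realType} {m n : nat}.
Variables (f : 'M[R]_(m, n) -> R) (gf : 'M[R]_(m, n) -> 'M[R]_(m, n)) (L fstar : R).
Variables (polar : 'M[R]_(m, n) -> 'M[R]_(m, n)) (beta eta : R).
Variables (G : nat -> 'M[R]_(m, n)) (X0 Cm1 : 'M[R]_(m, n)).
Hypothesis fgrad : has_gradient f gf.
Hypothesis f_ge : forall X, fstar <= f X.
Hypothesis gfL : forall X Y, normF (gf X - gf Y) <= L * normF (X - Y).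
Hypothesis L0 : 0 <= L.
Hypothesis polarP : forall M, is_polar M (polar M).
Hypothesis eta0 : 0 < eta.
Hypothesis beta01 : 0 < beta < 1.

Let b0 : 0 < beta. Proof. by case/andP: beta01. Qed.
Let b1 : beta < 1. Proof. by case/andP: beta01. Qed.
Let c0 : 0 < 1 - beta. Proof. by rewrite subr_gt0. Qed.

Let st := muon_state polar beta eta G X0 Cm1.
Let X k := (st k).1.
Let M k := beta *: (beta *: (st k).2 + G k) + G k.
Let S k := (1 - beta) *: M k - gf (X k).
Let N k := G k - gf (X k).
Let d0 : R := (minn m n)%:R.

Definition momentum_noise k := \sum_(j < k.+1) momentum_weight beta k j *: (G j - gf (muon_state polar beta eta G X0 Cm1 j).1).

Let XS k : X k.+1 = X k - eta *: polar (M k). Proof. by []. Qed.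

Let normF_step k : normF (X k - X k.+1) <= eta * Num.sqrt d0.
Proof.
rewrite XS opprD opprK addNKr normFZ ger0_norm ?(ltW eta0)// ler_wpM2l ?(ltW eta0)//.
exact: normF_polar.
Qed.

Let gradient_step k : normF (gf (X k) - gf (X k.+1)) <= L * (eta * Num.sqrt d0).
Proof. exact: (le_trans (gfL _ _) (ler_wpM2l L0 (normF_step k))). Qed.

Lemma normF_gradient_trajectory k : normF (gf (muon_state polar beta eta G X0 Cm1 k).1) <=
  normF (gf X0) + k%:R * (L * (eta * Num.sqrt (minn m n)%:R)).
Proof.
rewrite -/d0 -/st -/(X k); elim: k => [|k IH]; first by rewrite mul0r addr0.
have -> : gf (X k.+1) = gf (X k) - (gf (X k) - gf (X k.+1)) by rewrite subKr.
apply: (le_trans (normFB _ _)); rewrite -natr1 mulrDl mul1r addrA.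
by apply: lerD => //; exact: gradient_step.
Qed.

Let noiseS k : momentum_noise k.+1 =
  beta *: momentum_noise k + (1 - beta ^+ 2) *: N k.+1 - (beta * (1 - beta)) *: N k.
Proof.
have e : \sum_(i < k) momentum_weight beta k.+1 i *: N i =
    beta *: \sum_(i < k) momentum_weight beta k i *: N i.
  by rewrite scaler_sumr; apply: eq_bigr => i _; rewrite momentum_weightS_lt// -scalerA.
rewrite /momentum_noise -/st big_ord_recr /= big_ord_recr /= [in RHS]big_ord_recr /=.
rewrite momentum_weight_diag momentum_weightS_eq.
move: e; rewrite -/(N k) -/(N k.+1) => ->.
move: (\sum_(i < k) _) (N k) (N k.+1) (momentum_weight beta k k) => A u v w.
by apply/matrixP => i j; rewrite !mxE; ring.
Qed.

(** C_k is eliminated through beta C_k = M_k - G_k; what remains is a gradient increment and the two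
    latest noises. *)
Let momentumS k : S k.+1 = beta *: S k + beta ^+ 2 *: (gf (X k) - gf (X k.+1)) +
  (1 - beta ^+ 2) *: N k.+1 - (beta * (1 - beta)) *: N k.
Proof.
rewrite /S /M /N (_ : (st k.+1).2 = beta *: (st k).2 + G k)//.
move: (st k).2 (gf (X k)) (gf (X k.+1)) (G k) (G k.+1) => C g g' u u'.
by apply/matrixP => i j; rewrite !mxE; ring.
Qed.

Let drift := beta ^+ 2 / (1 - beta) * (L * (eta * Num.sqrt d0)).

(** The bound [drift] is the fixed point of x -> beta x + beta^2 L eta sqrt d0, the recursion left
    after the noise is subtracted. *)
Let normF_drift k : normF (S k - beta ^+ k *: S 0 - momentum_noise k) <= drift.
Proof.
have u0 : 0 <= L * (eta * Num.sqrt d0) by rewrite !mulr_ge0 ?(ltW eta0) ?sqrtr_ge0.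
elim: k => [|k IH].
  rewrite /momentum_noise big_ord1 /momentum_weight /= scale0r subr0 expr0 scale1r subrr normF0.
  by rewrite mulr_ge0// divr_ge0 ?sqr_ge0// ltW.
have -> : S k.+1 - beta ^+ k.+1 *: S 0 - momentum_noise k.+1 =
    beta *: (S k - beta ^+ k *: S 0 - momentum_noise k) + beta ^+ 2 *: (gf (X k) - gf (X k.+1)).
  rewrite momentumS noiseS (exprS beta k); move: (beta ^+ k) (S k) (S 0) (gf _) (gf _) (N k) (N k.+1) (momentum_noise k).
  by move=> bk s s0 g g' u u' v; apply/matrixP => i j; rewrite !mxE; ring.
apply: (le_trans (normFD _ _)); rewrite !normFZ !ger0_norm ?sqr_ge0 ?(ltW b0)//.
apply: (le_trans (lerD (ler_wpM2l (ltW b0) IH) (ler_wpM2l (sqr_ge0 beta) (gradient_step k)))).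
rewrite /drift le_eqVlt; apply/orP; left; apply/eqP.
by field; rewrite gt_eqF.
Qed.

Let normF_S k : normF (S k) <= beta ^+ k * normF (S 0) + drift + normF (momentum_noise k).
Proof.
have -> : S k = (S k - beta ^+ k *: S 0 - momentum_noise k) + momentum_noise k + beta ^+ k *: S 0.
  by rewrite addrNK addrNK.
apply: (le_trans (normFD _ _)); rewrite normFZ ger0_norm ?exprn_ge0 ?(ltW b0)//.
have := le_trans (normFD (S k - beta ^+ k *: S 0 - momentum_noise k) (momentum_noise k))
  (lerD (normF_drift k) (lexx _)).
by move: (normF _) (normF _) (_ * _) => u v w; lra.
Qed.

(** With Q the polar factor, |grad| <= (1 - beta)|M| + |S| <= (1 - beta)<M, Q> + |S| = <grad, Q> +
    <S, Q> + |S|, and <S, Q> <= sqrt d0 |S|. *)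
Let descent k : eta * normF (gf (X k)) <= f (X k) - f (X k.+1) +
  eta * (1 + Num.sqrt d0) * normF (S k) + L / 2 * eta ^+ 2 * d0.
Proof.
set Q := polar (M k); have PQ : is_polar (M k) Q by exact: polarP.
have dl := descent_lemma fgrad gfL (X k) (- (eta *: Q)).
rewrite -XS normFN normFZ frobNr frobZr exprMn ger0_norm ?(ltW eta0)// in dl.
have q2 : L / 2 * (eta ^+ 2 * normF Q ^+ 2) <= L / 2 * (eta ^+ 2 * d0).
  rewrite ler_wpM2l ?divr_ge0// ler_wpM2l ?sqr_ge0//; exact: normF_polar_sqr PQ.
have SQ : frob (S k) Q <= Num.sqrt d0 * normF (S k).
  apply: (le_trans (ler_norm _)); apply: (le_trans (frob_le _ _)); rewrite mulrC.
  by rewrite ler_wpM2r ?normF_ge0//; exact: normF_polar PQ.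
have MQ := ler_wpM2l (ltW c0) (normF_le_frob_polar PQ).
have gE : gf (X k) = (1 - beta) *: M k - S k by rewrite /S subKr.
have gn : normF (gf (X k)) <= (1 - beta) * normF (M k) + normF (S k).
  by rewrite gE; apply: (le_trans (normFB _ _)); rewrite normFZ ger0_norm ?(ltW c0).
have gQ : frob (gf (X k)) Q = (1 - beta) * frob (M k) Q - frob (S k) Q.
  by rewrite gE frobDl frobNl frobZl.
have main : normF (gf (X k)) <= frob (gf (X k)) Q + (1 + Num.sqrt d0) * normF (S k).
  by rewrite gQ; move: gn MQ SQ; lra.
have := ler_wpM2l (ltW eta0) main; move: dl q2.
move: (normF _) (normF (S k)) (normF Q ^+ 2) (frob _ _) (f _) (f _) (Num.sqrt _) => u v q w y z r.
by lra.
Qed.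

Lemma sum_gradient_trajectory (K : nat) :
  eta * \sum_(k < K) normF (gf (muon_state polar beta eta G X0 Cm1 k).1) <=
  f X0 - fstar + K%:R * (L / 2 * eta ^+ 2 * (minn m n)%:R) +
  eta * (1 + Num.sqrt (minn m n)%:R) *
   (normF ((1 - beta) *: (beta *: (beta *: Cm1 + G 0) + G 0) - gf X0) / (1 - beta) +
    K%:R * (beta ^+ 2 / (1 - beta) * (L * (eta * Num.sqrt (minn m n)%:R))) +
    \sum_(k < K) normF (momentum_noise k)).
Proof.
rewrite -/d0 -/drift.
have sumS : \sum_(k < K) normF (S k) <=
    normF (S 0) / (1 - beta) + K%:R * drift + \sum_(k < K) normF (momentum_noise k).
  apply: (le_trans (ler_sum _ (fun (k : 'I_K) _ => normF_S k))).
  rewrite !big_split /= sumr_const card_ord mulr_natl lerD2r lerD2r -mulr_suml mulrC.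
  (* Geometric series: (1 - beta) times the sum of beta^k over k < K is 1 - beta^K <= 1. *)
  rewrite ler_wpM2l ?normF_ge0// -div1r ler_pdivlMr// mulrC -[leLHS]opprK -mulNr opprB -subrX1 opprB.
  by rewrite lerBlDr lerDl exprn_ge0// ltW.
have telescope : eta * \sum_(k < K) normF (gf (X k)) <= f X0 - f (X K) +
    (eta * (1 + Num.sqrt d0) * \sum_(k < K) normF (S k) + K%:R * (L / 2 * eta ^+ 2 * d0)).
  elim: K {sumS} => [|K IH]; first by rewrite !big_ord0 subrr !mulr0 mul0r !addr0.
  rewrite !big_ord_recr /= -(natr1 K); have := lerD IH (descent K).
  move: (\sum_(k < K) _) (\sum_(k < K) _) (normF (gf _)) (normF (S _)) (f _) (f _) (f _) (K%:R : R) (Num.sqrt _).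
  by move=> u v w y a b c k s; lra.
have k0 : 0 <= eta * (1 + Num.sqrt d0) by rewrite mulr_ge0 ?(ltW eta0)// addr_ge0// sqrtr_ge0.
apply: (le_trans telescope).
have := ler_wpM2l k0 sumS; have := f_ge (X K).
rewrite -[(1 - beta) *: _ - _]/(S 0).
move: (\sum_(k < K) _) (normF (S 0) / _ + _ + _) (f _) (f _) (K%:R * (L / 2 * _ * _)) (eta * (1 + _)).
by move=> u v w y z k; lra.
Qed.

End Trajectory.

(** * Expectations along the trajectory *)

Lemma triangular_sum_le {R : realType} (K : nat) (W : nat -> nat -> R) (e : nat -> R) :
  (forall k j, 0 <= W k j) -> (forall j, \sum_(k < K) W k j <= 1) -> (forall j, 0 <= e j) ->
  \sum_(k < K) \sum_(j < k.+1) W k j * e j <= \sum_(j < K) e j.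
Proof.
move=> W0 W1 e0.
apply: (@le_trans _ _ (\sum_(k < K) \sum_(j < K) W k j * e j)).
  apply: ler_sum => k _.
  rewrite (big_ord_widen K (fun j => W k j * e j) (ltn_ord k)) big_mkcond.
  by apply: ler_sum => j _; case: ifP => // _; rewrite mulr_ge0.
rewrite exchange_big; apply: ler_sum => j _ /=.
by rewrite -mulr_suml ler_piMl.
Qed.

Section MuonExpectation.
Context {R : realType} {d : measure_display} {Omega : measurableType d}.
Variables (P : probability Omega R) (m n : nat).
Variables (f : 'M[R]_(m, n) -> R) (gf : 'M[R]_(m, n) -> 'M[R]_(m, n)) (L fstar : R).
Variables (polar : 'M[R]_(m, n) -> 'M[R]_(m, n)).
Variables (alpha sigma0 sigma1 beta eta : R) (B : nat).
Variables (F : nat -> set (set Omega)) (Gi : nat -> 'I_B -> Omega -> 'M[R]_(m, n)).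
Variables (X0 Cm1 : 'M[R]_(m, n)).
Hypothesis fgrad : has_gradient f gf.
Hypothesis f_ge : forall X, fstar <= f X.
Hypothesis gfL : forall X Y, normF (gf X - gf Y) <= L * normF (X - Y).
Hypothesis L0 : 0 <= L.
Hypothesis polarP : forall M, is_polar M (polar M).
Hypothesis alpha12 : 1 < alpha <= 2.
Hypothesis sigma00 : 0 <= sigma0.
Hypothesis sigma10 : 0 <= sigma1.
Hypothesis eta0 : 0 < eta.
Hypothesis beta01 : 0 < beta < 1.
Hypothesis B0 : (0 < B)%N.
Hypothesis filtF : filtration F.
Hypothesis FG : forall k i a b, Fmeas (F k.+1) (fun x => Gi k i x a b).
Hypothesis noise : heavy_tailed_noise P F Gi (muonX polar beta eta Gi X0 Cm1) gf alpha sigma0 sigma1.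

Let alpha1 : 1 <= alpha. Proof. by case/andP: alpha12 => /ltW. Qed.
Let alpha0 : 0 < alpha. Proof. exact: lt_le_trans alpha1. Qed.
Let d0 : R := (minn m n)%:R.
Let X := muonX polar beta eta Gi X0 Cm1.
Let g k x := gf (X k x).
Let V k x := sigma0 `^ alpha + sigma1 `^ alpha * normF (g k x) `^ alpha.
Let S0 x := (1 - beta) *: muonM polar beta eta Gi X0 Cm1 0 x - gf X0.
Let Q k x := momentum_noise gf polar beta eta (fun j => Gbatch Gi j x) X0 Cm1 k.

Let sF k : sub_sigma (F k). Proof. by case: filtF. Qed.

Let indepG k : cond_indep P (F k) (Gi k). Proof. by case: (noise k). Qed.

Let ceG k i a b : cond_exp_version P (F k) (fun x => Gi k i x a b) (fun x => g k x a b).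
Proof. by case: (noise k). Qed.

Let Fg k a b : Fmeas (F k) (fun x => g k x a b).
Proof. by case: (ceG k (Ordinal B0) a b). Qed.

Let Fng k : Fmeas (F k) (fun x => normF (g k x)).
Proof. exact: (Fmeas_normF (sF k) (Fg k)). Qed.

Let FV k : Fmeas (F k) (V k).
Proof.
apply: (FmeasD (sF k)); first exact: (Fmeas_cst (sF k)).
apply: (FmeasM (sF k)); first exact: (Fmeas_cst (sF k)).
exact: (Fmeas_powR (sF k) alpha (Fng k)).
Qed.

Let V0 k x : 0 <= V k x.
Proof. by rewrite addr_ge0 ?mulr_ge0 ?powR_ge0. Qed.

(** Deterministic bound on the gradient at iteration k, used for integrability only. *)
Let gb k : R := normF (gf X0) + k%:R * (L * (eta * Num.sqrt (minn m n)%:R)).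

Let g_le k x : normF (g k x) <= gb k.
Proof.
exact: (@normF_gradient_trajectory _ _ _ _ _ _ beta _ (fun j => Gbatch Gi j x) X0 Cm1 gfL L0 polarP eta0 k).
Qed.

Let V_le k x : V k x <= sigma0 `^ alpha + sigma1 `^ alpha * gb k `^ alpha.
Proof.
rewrite lerD2l ler_wpM2l ?powR_ge0// ge0_ler_powR ?nnegrE ?(ltW alpha0) ?normF_ge0//.
exact: le_trans (normF_ge0 _) (g_le k x).
Qed.

Let Vb k : exists v, forall x, V k x <= v.
Proof. by exists (sigma0 `^ alpha + sigma1 `^ alpha * gb k `^ alpha). Qed.

Let mD k i : measurable_fun setT (fun x => normF (Gi k i x - g k x) `^ alpha).
Proof.
apply: (measurableT_comp (measurable_powR alpha)); apply: measurable_normF => a b.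
under eq_fun do rewrite !mxE.
apply: measurable_funB; first exact: (Fmeas_measurable (sF k.+1) (FG k i a b)).
exact: (Fmeas_measurable (sF k) (Fg k a b)).
Qed.

Let V01 k x : 0 <= V k x <= sigma0 `^ alpha + sigma1 `^ alpha * gb k `^ alpha.
Proof. by rewrite V0 V_le. Qed.

Let iG k i : P.-integrable setT (EFin \o (fun x => normF (Gi k i x - g k x) `^ alpha)).
Proof.
case: (noise k) => _ _ /(_ i) [Y [ceY YV]].
exact: (ncond_exp_integrable (sF k) ceY YV (FV k) (V01 k) (mD k i) (fun x => powR_ge0 _ _)).
Qed.

Let momentG k i (lam : Omega -> R) e : Fmeas (F k) lam -> (forall x, 0 <= lam x <= e) ->
  \int[P]_x (lam x * normF (Gi k i x - g k x) `^ alpha) <= \int[P]_x (lam x * V k x).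
Proof.
case: (noise k) => _ _ /(_ i) [Y [ceY YV]].
exact: (ncond_exp_mul_le (sF k) ceY YV (FV k) (V01 k) (mD k i) (fun x => powR_ge0 _ _)).
Qed.

Let batch_noiseE k x : Gbatch Gi k x - g k x = batch_noise Gi g k x.
Proof.
rewrite /batch_noise /Gbatch big_split /= sumrN sumr_const card_ord scalerBr; congr (_ - _).
by rewrite -(scaler_nat B (g k x)) scalerA mulVf ?scale1r// pnatr_eq0 -lt0n.
Qed.

Let QE k : Q k = noise_sum Gi g (momentum_weight beta k) k.+1.
Proof.
apply/funext => x; rewrite /Q /momentum_noise /noise_sum; apply: eq_bigr => j _.
by rewrite -batch_noiseE.
Qed.

Lemma integrable_normF_gradient k : P.-integrable setT (EFin \o (fun x => normF (g k x))).
Proof.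
apply: (integrable_dominated (Fmeas_measurable (sF k) (Fng k)) (integrable_constant P (gb k))) => x.
by rewrite ger0_norm ?normF_ge0.
Qed.

Let iQ k : P.-integrable setT (EFin \o (fun x => normF (Q k x))).
Proof.
rewrite QE.
exact: (integrable_normF_noise_sum (momentum_weight beta k) alpha12 filtF FG indepG ceG Fg iG FV V0 Vb momentG ltr01 k.+1).
Qed.

Lemma integrable_normF_S0 : P.-integrable setT (EFin \o (fun x => normF (S0 x))).
Proof.
(* S_0 is affine in the noise of iteration 0, but [momentum_weight] vanishes at (0, 0); a single
   term with coefficient 1 recovers that noise. *)
pose N x := noise_sum Gi g (fun=> 1) 1 x.
have iN : P.-integrable setT (EFin \o (fun x => normF (N x))).
  exact: (integrable_normF_noise_sum (fun=> 1) alpha12 filtF FG indepG ceG Fg iG FV V0 Vb momentG ltr01 1).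
pose C := ((1 - beta) * beta ^+ 2) *: Cm1 - beta ^+ 2 *: gf X0.
have SE x : S0 x = (1 - beta ^+ 2) *: N x + C.
  rewrite /N /noise_sum big_ord1 scale1r -batch_noiseE /S0 /muonM /=.
  rewrite (_ : g 0 x = gf X0)// /C; move: (Gbatch _ _ _) (gf X0) => u v.
  by apply/matrixP => i j; rewrite !mxE; ring.
have mN : rmx_meas N.
  move=> a b; exact: (Fmeas_measurable (sF 1) (Fmeas_noise_sum (fun=> 1) filtF FG Fg 1 a b)).
apply: (integrable_dominated _ (integrable_addr (integrable_mulrl `|1 - beta ^+ 2| iN) (integrable_constant P (normF C)))).
  apply: measurable_normF => a b; under eq_fun do rewrite SE !mxE.
  by apply: measurable_funD => //; apply: measurable_funM => //.
by move=> x; rewrite ger0_norm ?normF_ge0// SE (le_trans (normFD _ _))// normFZ.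
Qed.

Let e k := \int[P]_x normF (g k x).

Let c : R := (B%:R `^ ((alpha - 1) / alpha))^-1.
Let Gamma : R := (2 `^ alpha + 1) `^ alpha^-1.

Lemma expected_momentum_noise k : \int[P]_x normF (Q k x) <= 2 * Num.sqrt pi * (c *
  (Gamma * (1 - beta) `^ ((alpha - 1) / alpha) * sigma0 +
   sigma1 * \sum_(j < k.+1) `|momentum_weight beta k j| * e j)).
Proof.
have c0 : 0 < 1 - beta by case/andP: beta01; rewrite subr_gt0.
have sp : 0 <= 2 * Num.sqrt (pi : R) by rewrite mulr_ge0// sqrtr_ge0.
rewrite QE.
apply: (le_trans (expected_noise_sum (momentum_weight beta k) alpha12 filtF FG indepG ceG Fg iG FV V0 Vb momentG k.+1)).
rewrite ler_wpM2l//.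
pose w := momentum_weight beta k.
pose A := Gamma * (1 - beta) `^ ((alpha - 1) / alpha) * sigma0.
have iwg (j : 'I_k.+1) : P.-integrable setT (EFin \o (fun x => `|w j| * normF (g j x))).
  exact: (integrable_mulrl `|w j| (integrable_normF_gradient j)).
have isum : P.-integrable setT (EFin \o (fun x => \sum_(j < k.+1) `|w j| * normF (g j x))).
  exact: integrable_sumr.
have is1 := integrable_mulrl sigma1 isum.
have iA := integrable_constant P A.
have itot := integrable_mulrl c (integrable_addr iA is1).
have -> : c * (A + sigma1 * \sum_(j < k.+1) `|w j| * e j) =
    \int[P]_x (c * (A + sigma1 * \sum_(j < k.+1) `|w j| * normF (g j x))).
  rewrite (RintegralZl _ measurableT (integrable_addr iA is1)) (RintegralD measurableT iA is1).
  rewrite Rintegral_constant (RintegralZl _ measurableT isum) Rintegral_sumr//.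
  congr (c * (A + sigma1 * _)); apply: eq_bigr => j _.
  by rewrite (RintegralZl _ measurableT (integrable_normF_gradient j)).
have le x : variation B V alpha w 0 k.+1 x `^ alpha^-1 <=
    c * (A + sigma1 * \sum_(j < k.+1) `|w j| * normF (g j x)).
  rewrite /variation add0r.
  have b0 : 0 <= B%:R * (B%:R)^-1 `^ alpha :> R by rewrite mulr_ge0 ?powR_ge0.
  apply: (le_trans (weighted_moment_root_le _ w alpha1 b0 sigma00 sigma10 (fun j => normF_ge0 (g j x)))).
  rewrite batch_factor_root// -/c ler_wpM2l ?invr_ge0 ?powR_ge0// lerD2r ler_wpM2r//.
  have -> : Gamma * (1 - beta) `^ ((alpha - 1) / alpha) =
      ((2 `^ alpha + 1) * (1 - beta) `^ (alpha - 1)) `^ alpha^-1.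
    by rewrite powRM ?powR_ge0 ?addr_ge0 ?powR_ge0// -powRrM.
  apply: ge0_ler_powR; rewrite ?nnegrE ?invr_ge0 ?(ltW alpha0)//.
  - by apply: sumr_ge0 => j _; exact: powR_ge0.
  - by rewrite mulr_ge0 ?addr_ge0 ?powR_ge0.
  - exact: (momentum_weight_powR alpha12 beta01 k).
apply: (le_Rintegral measurableT _ itot (fun x _ => le x)).
have mv := @measurable_variation _ _ _ F B V alpha w filtF FV 0 k.+1.
apply: (integrable_dominated _ itot); first exact: (measurableT_comp (measurable_powR alpha^-1) mv).
by move=> x; rewrite ger0_norm ?powR_ge0.
Qed.

Lemma sum_expected_momentum_noise K : \sum_(k < K) \int[P]_x normF (Q k x) <=
  2 * Num.sqrt pi * (c * (K%:R * (Gamma * (1 - beta) `^ ((alpha - 1) / alpha) * sigma0) +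
   sigma1 * \sum_(k < K) e k)).
Proof.
apply: (le_trans (ler_sum _ (fun (k : 'I_K) _ => expected_momentum_noise k))).
rewrite -!mulr_sumr big_split /= sumr_const card_ord -[_ *+ K]mulr_natl.
rewrite ler_wpM2l ?mulr_ge0 ?sqrtr_ge0// ler_wpM2l ?invr_ge0 ?powR_ge0// lerD2l.
rewrite -mulr_sumr ler_wpM2l//.
apply: (@triangular_sum_le _ K (fun k j => `|momentum_weight beta k j|) e) => // j; first exact: (momentum_weight_column beta01 K j).
by apply: Rintegral_ge0 => x _; exact: normF_ge0.
Qed.

Lemma expected_gradient_sum K : eta * \sum_(k < K) e k <=
  f X0 - fstar + K%:R * (L / 2 * eta ^+ 2 * d0) + eta * (1 + Num.sqrt d0) *
  (\int[P]_x normF (S0 x) / (1 - beta) +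
   K%:R * (beta ^+ 2 / (1 - beta) * (L * (eta * Num.sqrt d0))) +
   2 * Num.sqrt pi * (c * (K%:R * (Gamma * (1 - beta) `^ ((alpha - 1) / alpha) * sigma0) +
     sigma1 * \sum_(k < K) e k))).
Proof.
have ig : P.-integrable setT (EFin \o (fun x => \sum_(k < K) normF (g k x))).
  by apply: integrable_sumr => k; exact: integrable_normF_gradient.
have iq : P.-integrable setT (EFin \o (fun x => \sum_(k < K) normF (Q k x))).
  by apply: integrable_sumr => k; exact: iQ.
pose A := f X0 - fstar + K%:R * (L / 2 * eta ^+ 2 * d0).
pose D := K%:R * (beta ^+ 2 / (1 - beta) * (L * (eta * Num.sqrt d0))).
pose C := eta * (1 + Num.sqrt d0).
have C0 : 0 <= C by rewrite mulr_ge0 ?(ltW eta0)// addr_ge0// sqrtr_ge0.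
have iS := integrable_mulrl (1 - beta)^-1 integrable_normF_S0.
have iSD := integrable_addr iS (integrable_constant P D).
have iSDq := integrable_mulrl C (integrable_addr iSD iq).
have itot := integrable_addr (integrable_constant P A) iSDq.
have pw x : eta * \sum_(k < K) normF (g k x) <=
    A + C * ((1 - beta)^-1 * normF (S0 x) + D + \sum_(k < K) normF (Q k x)).
  apply: (le_trans (sum_gradient_trajectory (fun j => Gbatch Gi j x) X0 Cm1 fgrad f_ge gfL L0 polarP eta0 beta01 K)).
  by rewrite [X in _ <= _ + _ * (X + _ + _)]mulrC.
have := le_Rintegral measurableT (integrable_mulrl eta ig) itot (fun x _ => pw x).
rewrite (RintegralZl _ measurableT ig) (RintegralD measurableT (integrable_constant P A) iSDq).
rewrite (RintegralZl _ measurableT (integrable_addr iSD iq)) (RintegralD measurableT iSD iq).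
rewrite (RintegralD measurableT iS (integrable_constant P D)).
rewrite (RintegralZl _ measurableT integrable_normF_S0) !Rintegral_constant.
rewrite (Rintegral_sumr _ (fun k : 'I_K => integrable_normF_gradient k)) (Rintegral_sumr _ (fun k : 'I_K => iQ k)).
move=> /le_trans; apply.
rewrite -/A -/C -/D lerD2l ler_wpM2l// [X in _ <= X + _ + _]mulrC lerD2l.
exact: sum_expected_momentum_noise.
Qed.

End MuonExpectation.

(** * Assembly of the rate *)

Lemma convergence_rate_arithmetic {R : realType}
  (A E L L' d0 r eta beta s t b C q Gamma sigma0 sigma1 g0 k rho : R) :
  L * d0 = L' * d0 -> L * r = L' * r -> 0 <= r -> 0 < eta -> 0 < 1 - beta -> 0 < b -> 0 < k ->
  0 <= t -> 1 <= C -> 0 <= sigma0 -> 0 <= sigma1 -> 0 <= Gamma -> 0 <= q -> 0 <= g0 -> 0 <= E ->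
  rho = 1 - (1 + r) * t * C * sigma1 / b -> 0 < rho ->
  eta * E <= A + k * (L' / 2 * eta ^+ 2 * d0) + eta * (1 + r) *
    (s / (1 - beta) + k * (beta ^+ 2 / (1 - beta) * (L' * (eta * r))) +
     t * (b^-1 * (k * (Gamma * q * sigma0) + sigma1 * E))) ->
  E / k <= A / (eta * rho * k) + L * d0 * eta / (2 * rho)
    + (1 + r) / ((1 - beta) * k * rho) * s
    + beta ^+ 2 / ((1 - beta) * rho) * L * eta * r * (1 + r)
    + (1 + r) * (t * C) / (rho * b) * Gamma * sigma0 * q
    + (1 + r) * (t * C * sigma1 * g0) / (rho * b * k).
Proof.
move=> Ld Lr r0 eta0 c0 b0 k0 t0 C1 s00 s10 G0 q0 g00 E0 rhoE rho0 h.
have C0 : 0 <= C by lra.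
have r1 : 0 <= 1 + r by lra.
have last0 : 0 <= (1 + r) * (t * C * sigma1 * g0) / (rho * b * k).
  by rewrite divr_ge0 ?mulr_ge0 ?(ltW rho0) ?(ltW b0) ?(ltW k0)//.
(* The term in |grad f(X_0)| is nonnegative, so it suffices to prove the bound formed by the other
   five. *)
apply: ler_wpDr => //.
have -> : L * d0 * eta / (2 * rho) = L' * d0 * eta / (2 * rho) by rewrite Ld.
have -> : beta ^+ 2 / ((1 - beta) * rho) * L * eta * r * (1 + r) =
    beta ^+ 2 / ((1 - beta) * rho) * (L' * r) * eta * (1 + r) by rewrite -Lr; ring.
have p0 : 0 < eta * rho by rewrite mulr_gt0.
have noise_le : t * (b^-1 * (k * (Gamma * q * sigma0) + sigma1 * E)) <=
    t * C * (b^-1 * (k * (Gamma * q * sigma0) + sigma1 * E)).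
  rewrite ler_wpM2r ?ler_peMr//.
  by rewrite mulr_ge0 ?invr_ge0 ?(ltW b0)// addr_ge0 ?mulr_ge0 ?(ltW k0).
have key : eta * rho * E <= A + k * (L' / 2 * eta ^+ 2 * d0) + eta * (1 + r) *
    (s / (1 - beta) + k * (beta ^+ 2 / (1 - beta) * (L' * (eta * r))) +
     t * C * (b^-1 * (k * (Gamma * q * sigma0)))).
  (* The sigma1 part of the noise is proportional to E and moves to the left, where it turns eta
     into eta rho. *)
  have -> : eta * rho * E = eta * E - eta * (1 + r) * (t * C * (b^-1 * (sigma1 * E))).
    by rewrite rhoE; ring.
  have split_noise : t * (b^-1 * (k * (Gamma * q * sigma0) + sigma1 * E)) <=
      t * C * (b^-1 * (k * (Gamma * q * sigma0))) + t * C * (b^-1 * (sigma1 * E)).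
    by rewrite -mulrDr -mulrDr.
  have kc0 : 0 <= eta * (1 + r) by rewrite mulr_ge0// ltW.
  move: h (ler_wpM2l kc0 split_noise).
  move: (t * (_ * _)) (t * C * (_ * _)) (t * C * (_ * _)) (s / _ + _) (eta * (1 + r)) (A + _) (eta * E).
  by move=> n1 n2 n3 u kc a y; lra.
rewrite ler_pdivrMr// -(ler_pM2l p0); apply: (le_trans key).
rewrite le_eqVlt; apply/orP; left; apply/eqP; field.
by rewrite !gt_eqF.
Qed.

Lemma bigmine_le_average {R : realType} (K : nat) (x : nat -> \bar R) (e : nat -> R) :
  (0 < K)%N -> (forall k, x k = (e k)%:E) ->
  (\big[mine/+oo]_(k < K) x k <= ((\sum_(k < K) e k) / K%:R)%:E)%E.
Proof.
move=> K0 xe; set avg := _ / _.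
have [k ke] : exists k : 'I_K, e k <= avg.
  apply: contrapT => /forallNP h.
  have : \sum_(k < K) avg < \sum_(k < K) e k.
    apply: ltr_sum; first by apply/hasP; exists (Ordinal K0); rewrite ?mem_index_enum.
    by move=> k _; rewrite ltNge; apply/negP; exact: h.
  by rewrite sumr_const card_ord -mulr_natr divfK ?ltxx// pnatr_eq0 -lt0n.
apply: (@le_trans _ _ (x k)); first exact: bigmin_le_cond.
by rewrite xe lee_fin.
Qed.

(** A negative L forces one of the dimensions to be zero; then every L in the bound is multiplied by
    d0 = 0 or its root, and L' = 0 serves. *)
Lemma nonneg_lipschitz_constant {R : realType} (m n : nat)
  (gf : 'M[R]_(m, n) -> 'M[R]_(m, n)) (L : R) :
  (forall X Y, normF (gf X - gf Y) <= L * normF (X - Y)) ->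
  exists L', [/\ 0 <= L', forall X Y, normF (gf X - gf Y) <= L' * normF (X - Y),
    L * (minn m n)%:R = L' * (minn m n)%:R &
    L * Num.sqrt (minn m n)%:R = L' * Num.sqrt (minn m n)%:R].
Proof.
move=> gfL; have [L0|L0] := leP 0 L; first by exists L.
have -> : minn m n = 0%N.
  apply/eqP; rewrite -leqn0 leqNgt; apply/negP; rewrite leq_min => /andP[m0 n0].
  have := normF_entry (const_mx 1 - 0 : 'M[R]_(m, n)) (Ordinal m0) (Ordinal n0).
  rewrite !mxE subr0 normr1 => h1.
  have := le_trans (normF_ge0 _) (gfL (const_mx 1) 0).
  by rewrite leNgt nmulr_rlt0// (lt_le_trans ltr01).
exists 0; rewrite sqrtr0 !mulr0; split => // X Y.
by rewrite (le_trans (gfL X Y))// mul0r mulr_le0_ge0 ?(ltW L0) ?normF_ge0.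
Qed.

(** The two exponents are reciprocal, so this turns the batch size condition into rho > 0. *)
Lemma batch_size_contraction {R : realType} (alpha x b : R) : 1 < alpha -> 0 <= x -> 0 <= b ->
  x `^ (alpha / (alpha - 1)) < b -> x < b `^ ((alpha - 1) / alpha).
Proof.
move=> a1 x0 b0 h; have p0 : 0 < (alpha - 1) / alpha by apply: divr_gt0; lra.
have := gt0_ltr_powR p0; move=> /(_ _ _ _ _ h); rewrite -powRrM.
rewrite (_ : alpha / (alpha - 1) * ((alpha - 1) / alpha) = 1); last by field; apply/andP; split; lra.
by rewrite powRr1//; apply; rewrite nnegrE ?powR_ge0.
Qed.

Theorem mainTheorem14 (R : realType) (d : measure_display) (Omega : measurableType d)
  (P : probability Omega R) (m n : nat)
  (f : 'M[R]_(m, n) -> R) (gf : 'M[R]_(m, n) -> 'M[R]_(m, n)) (L fstar : R)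
  (polar : 'M[R]_(m, n) -> 'M[R]_(m, n))
  (alpha sigma0 sigma1 Calpha beta eta : R) (K B : nat)
  (F : nat -> set (set Omega)) (Gi : nat -> 'I_B -> Omega -> 'M[R]_(m, n))
  (X0 Cm1 : 'M[R]_(m, n)) :
  (* f differentiable with gradient gf, bounded below, L-smooth *)
  has_gradient f gf ->
  (forall X, fstar <= f X) ->
  (forall X Y, normF (gf X - gf Y) <= L * normF (X - Y)) ->
  (* exact polar decomposition *)
  (forall M, is_polar M (polar M)) ->
  (* the constant C_alpha *)
  0 < Calpha <= 2 -> vBE_constant alpha Calpha ->
  (* parameters *)
  1 < alpha <= 2 -> 0 <= sigma0 -> 0 <= sigma1 ->
  (1 <= K)%N -> 0 < eta -> 0 < beta < 1 ->
  (2 * Num.sqrt pi * (1 + Num.sqrt (minn m n)%:R) * Calpha `^ alpha^-1 * sigma1)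
      `^ (alpha / (alpha - 1)) < B%:R ->
  (* filtration and the noise assumption *)
  filtration F ->
  (forall k i a b, Fmeas (F k.+1) (fun x => Gi k i x a b)) ->
  heavy_tailed_noise P F Gi (muonX polar beta eta Gi X0 Cm1) gf alpha sigma0 sigma1 ->
  let d0 : R := (minn m n)%:R in
  let rho : R := 1 - (1 + Num.sqrt d0) * (2 * Num.sqrt pi) * Calpha `^ alpha^-1 * sigma1
                       / B%:R `^ ((alpha - 1) / alpha) in
  let Gamma : R := (2 `^ alpha + 1) `^ alpha^-1 in
  let S0 := fun x => (1 - beta) *: muonM polar beta eta Gi X0 Cm1 0 x - gf X0 in
  (\big[mine/+oo]_(k < K) \int[P]_x (normF (gf (muonX polar beta eta Gi X0 Cm1 k x)))%:E
   <=
   ((f X0 - fstar) / (eta * rho * K%:R))%:E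
   + (L * d0 * eta / (2 * rho))%:E
   + ((1 + Num.sqrt d0) / ((1 - beta) * K%:R * rho))%:E * \int[P]_x (normF (S0 x))%:E
   + (beta ^+ 2 / ((1 - beta) * rho) * L * eta * Num.sqrt d0 * (1 + Num.sqrt d0))%:E
   + ((1 + Num.sqrt d0) * (2 * Num.sqrt pi * Calpha `^ alpha^-1)
        / (rho * B%:R `^ ((alpha - 1) / alpha)) * Gamma * sigma0
        * (1 - beta) `^ ((alpha - 1) / alpha))%:E
   + ((1 + Num.sqrt d0) * (2 * Num.sqrt pi * Calpha `^ alpha^-1 * sigma1 * normF (gf X0))
        / (rho * B%:R `^ ((alpha - 1) / alpha) * K%:R))%:E)%E.
Proof.
move=> fgrad f_ge gfL polarP _ vBE alpha12 sigma00 sigma10 K1 eta0 beta01 Bbig filtF FG noise.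
cbv zeta.
set d0 : R := (minn m n)%:R; set rho : R := 1 - _ / _.
set S0 := fun x => (1 - beta) *: _ - gf X0.
have [L' [L'0 gfL' Ld Lr]] := nonneg_lipschitz_constant gfL.
have C1 := vBE_constant_ge1 vBE.
have alpha1 : 1 < alpha by case/andP: alpha12.
have alpha0 : 0 < alpha by exact: lt_trans alpha1.
have Ca1 : 1 <= Calpha `^ alpha^-1.
  have -> : 1 = 1 `^ alpha^-1 :> R by rewrite powR1.
  apply: ge0_ler_powR; rewrite ?nnegrE ?invr_ge0 ?(ltW alpha0)//.
  exact: le_trans ler01 C1.
(* A real power is nonnegative, so the strict batch size condition already excludes an empty
   batch. *)
have BR : 0 < B%:R :> R by rewrite (le_lt_trans (powR_ge0 _ _) Bbig).
have B0 : (0 < B)%N by rewrite -(ltr0n R).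
have r0 : 0 <= Num.sqrt d0 by exact: sqrtr_ge0.
have t0 : 0 <= 2 * Num.sqrt (pi : R) by rewrite mulr_ge0// sqrtr_ge0.
have b0 : 0 < B%:R `^ ((alpha - 1) / alpha) :> R by exact: powR_gt0.
have rho0 : 0 < rho.
  rewrite subr_gt0 ltr_pdivrMr// mul1r.
  rewrite (_ : (1 + Num.sqrt d0) * _ * _ * _ =
    2 * Num.sqrt pi * (1 + Num.sqrt (minn m n)%:R) * Calpha `^ alpha^-1 * sigma1).
    apply: batch_size_contraction => //.
    by rewrite !mulr_ge0 ?addr_ge0 ?powR_ge0 ?sqrtr_ge0.
  by rewrite /d0; ring.
have c0 : 0 < 1 - beta by case/andP: beta01; rewrite subr_gt0.
have K0 : 0 < K%:R :> R by rewrite ltr0n.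
pose e k := \int[P]_x normF (gf (muonX polar beta eta Gi X0 Cm1 k x)).
have eE k : (\int[P]_x (normF (gf (muonX polar beta eta Gi X0 Cm1 k x)))%:E)%E = (e k)%:E.
  rewrite [RHS]fineK//.
  exact: (integrable_fin_num measurableT (integrable_normF_gradient gfL' L'0 polarP eta0 B0 filtF noise k)).
have SE : (\int[P]_x (normF (S0 x))%:E)%E = (\int[P]_x normF (S0 x))%:E.
  rewrite [RHS]fineK//.
  exact: (integrable_fin_num measurableT (integrable_normF_S0 gfL' L'0 polarP alpha12 eta0 B0 filtF FG noise)).
apply: (le_trans (bigmine_le_average K1 eE)).
rewrite SE -EFinM -!EFinD lee_fin.
have e0 : 0 <= \sum_(k < K) e k.
  by apply: sumr_ge0 => k _; apply: Rintegral_ge0 => x _; exact: normF_ge0.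
have rhoE : rho = 1 - (1 + Num.sqrt d0) * (2 * Num.sqrt pi) * Calpha `^ alpha^-1 * sigma1 /
    B%:R `^ ((alpha - 1) / alpha) by [].
have bound := expected_gradient_sum fgrad f_ge gfL' L'0 polarP alpha12 sigma00 sigma10 eta0 beta01 B0
  filtF FG noise K.
have H := convergence_rate_arithmetic Ld Lr r0 eta0 c0 b0 K0 t0 Ca1 sigma00 sigma10 (powR_ge0 _ _)
  (powR_ge0 _ _) (normF_ge0 (gf X0)) e0 rhoE rho0 bound.
exact: H.
Qed.
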